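(* Let $d\ge 1$, $M>0$ and $\delta>0$. There exists a constant $C_0=C_0(\delta,M,d)>0$ such that for all probability measures $\pi$ and $\eta$ supported on the cube $[-M,M]^d$, $$\sqrt{\chi^2(f_\pi\|f_\eta)}\le\Big(C_0\vee \mathrm{TV}(f_\pi,f_\eta)^{-\alpha(\mathrm{TV}(f_\pi,f_\eta))}\Big)\,\mathrm{TV}(f_\pi,f_\eta),$$ where, for $t>0$, $$\alpha(t):=\frac{2+\delta}{\log\big(\log(1/t)\vee e\big)}.$$
   Context: For a probability measure $\pi$ on $\mathbb R^d$, $f_\pi(x):=\int_{\mathbb R^d}\phi_d(x-\theta)\,d\pi(\theta)$ is the Gaussian location mixture density, where $\phi_d(x)=(2\pi)^{-d/2}\exp(-\|x\|_2^2/2)$. For densities $p,q$ on $\mathbb R^d$: $\mathrm{TV}(p,q)=\frac12\int|p-q|$ and $\chi^2(p\|q)=\int\frac{(p-q)^2}{q}$. $a\vee b=\max\{a,b\}$. When $\mathrm{TV}(f_\pi,f_\eta)=0$ the right-hand side is read as $0$. *)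

(* Defs.v *)
From HB Require Import structures.
From mathcomp Require Import all_boot all_order all_algebra.
From mathcomp Require Import all_classical all_reals all_analysis.

Set Implicit Arguments.
Unset Strict Implicit.
Unset Printing Implicit Defensive.

Import Order.TTheory GRing.Theory Num.Theory.
Import numFieldNormedType.Exports.

Local Open Scope classical_set_scope.
Local Open Scope ring_scope.

Section cons_tuple.
Context {dsp : measure_display} {T : measurableType dsp} {n : nat}.

Definition cons_tuple (p : T * n.-tuple T) : n.+1.-tuple T :=
  [tuple of p.1 :: p.2].

Definition uncons_tuple (t : n.+1.-tuple T) : T * n.-tuple T :=
  (thead t, [tuple of behead t]).

Lemma cons_tupleK : cancel cons_tuple uncons_tuple.
Proof. by case=> a t; congr pair; apply/val_inj. Qed.

Lemma measurable_cons_tuple : measurable_fun setT cons_tuple.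
Proof. by apply: measurable_cons. Qed.

Lemma measurable_uncons_tuple : measurable_fun setT uncons_tuple.
Proof.
apply/measurable_fun_pairP; split; last exact: measurable_behead.
exact: measurable_tnth.
Qed.

HB.instance Definition _ :=
  isMeasurableFun.Build _ _ _ _ cons_tuple measurable_cons_tuple.

End cons_tuple.

Section cons_measure.
Local Open Scope ereal_scope.
Context {dsp : measure_display} {T : measurableType dsp} {R : realType}.
Variables (mu : {sigma_finite_measure set T -> \bar R}) (n : nat).
Variable nu : {sigma_finite_measure set (n.-tuple T) -> \bar R}.

(* the product measure mu \x nu, transported to (n+1)-tuples *)
Definition cons_measure : set (n.+1.-tuple T) -> \bar R :=
  pushforward (mu \x nu) cons_tuple.

Let cons_measure0 : cons_measure set0 = 0.
Proof. exact: measure0. Qed.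

Let cons_measure_ge0 A : 0 <= cons_measure A.
Proof. exact: measure_ge0. Qed.

Let cons_measure_sigma_additive : semi_sigma_additive cons_measure.
Proof. exact: measure_semi_sigma_additive. Qed.

HB.instance Definition _ := isMeasure.Build _ _ _ cons_measure
  cons_measure0 cons_measure_ge0 cons_measure_sigma_additive.

Let cons_measure_sigma_finite : sigma_finite setT cons_measure.
Proof.
have /sigma_finiteP[F [TF ndF Foo]] := sigma_finiteT mu.
have /sigma_finiteP[G [TG ndG Goo]] := sigma_finiteT nu.
have mFG k : measurable (F k `*` G k).
  by apply: measurableX; [have [] := Foo k|have [] := Goo k].
exists (fun k => uncons_tuple @^-1` (F k `*` G k)) => [|k].
  apply/seteqP; split=> // t _.
  have [i _ Fi] : (\bigcup_i F i) (uncons_tuple t).1 by rewrite -TF.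
  have [j _ Gj] : (\bigcup_j G j) (uncons_tuple t).2 by rewrite -TG.
  exists (maxn i j) => //; split => /=.
    by move: Fi; exact/subsetPset/ndF/leq_maxl.
  by move: Gj; exact/subsetPset/ndG/leq_maxr.
split; first by rewrite -[X in measurable X]setTI; exact: measurable_uncons_tuple.
rewrite /cons_measure /pushforward -comp_preimage.
rewrite (_ : uncons_tuple \o cons_tuple = id); last first.
  by apply/funext; exact: cons_tupleK.
have [[mF Fk] [mG Gk]] := (Foo k, Goo k).
by rewrite preimage_id product_measure1E// lte_mul_pinfty// ge0_fin_numE.
Qed.

HB.instance Definition _ := Measure_isSigmaFinite.Build _ _ _
  cons_measure cons_measure_sigma_finite.

End cons_measure.

Section tuple_measure.
Local Open Scope ereal_scope.
Context {dsp : measure_display} {T : measurableType dsp} {R : realType}.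
Variable mu : {sigma_finite_measure set T -> \bar R}.

Fixpoint tuple_measure (n : nat) :
    {sigma_finite_measure set (n.-tuple T) -> \bar R} :=
  match n with
  | 0%N => \d_([tuple] : 0.-tuple T)
  | m.+1 => cons_measure mu (tuple_measure m)
  end.

Lemma tuple_measure_box (n : nat) (A : 'I_n -> set T) :
  (forall i, measurable (A i)) ->
  tuple_measure n [set t | forall i, A i (tnth t i)] = \prod_(i < n) mu (A i).
Proof.
elim: n A => [|n IH] A mA.
  by rewrite big_ord0 /= diracE mem_set//= => -[].
rewrite big_ord_recl -IH// -product_measure1E//; last first.
  rewrite (_ : mkset _ = \bigcap_(i in [set: 'I_n])
      ((@tnth _ T)^~ i @^-1` A (lift ord0 i))); last first.
    by apply/seteqP; split=> [t At i _|t At i]; [exact: At|exact: At].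
  apply: fin_bigcap_measurable => // i _.
  by rewrite -[X in measurable X]setTI; exact: measurable_tnth.
congr (product_measure1 _ _ _); apply/seteqP; split => -[a t] /=.
  move=> At; split; first exact: (At ord0).
  by move=> i; have := At (lift ord0 i); rewrite tnthS.
by case=> Aa At i; case: (unliftP ord0 i) => [j|] -> //; rewrite tnthS.
Qed.

End tuple_measure.

(* The tuple sigma-algebra is the one generated by the coordinates, so this is *)
(* R^d with its Borel sigma-algebra; measurableTypeR R rather than R because   *)
(* lebesgue_measure is defined on it.                                          *)
Notation Rd R d := (d.-tuple (measurableTypeR R)).

Section gaussian_mixture.
Context {R : realType} {d : nat}.
Implicit Types (x y : Rd R d) (p q : Rd R d -> R).

Definition lebesgue_Rd : {sigma_finite_measure set (Rd R d) -> \bar R} :=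
  tuple_measure lebesgue_measure d.

Definition Rd_coord x (i : 'I_d) : R := tnth x i.

Definition sub_Rd x y : Rd R d := [tuple Rd_coord x i - Rd_coord y i | i < d].

Definition norm2 x : R := Num.sqrt (\sum_(i < d) Rd_coord x i ^+ 2).

Definition gauss_density x : R :=
  (2 * pi) `^ (- (d%:R / 2)) * expR (- (norm2 x ^+ 2 / 2)).

Definition gauss_mixture (P : probability (Rd R d) R) x : R :=
  (\int[P]_theta gauss_density (sub_Rd x theta))%R.

(* real-valued: the integral is finite when p and q are integrable *)
Definition TV p q : R := 2^-1 * (\int[lebesgue_Rd]_x `|p x - q x|)%R.

(* extended-real valued: the finiteness of the integral is not presupposed *)
Definition chi2 p q : \bar R :=
  (\int[lebesgue_Rd]_x ((p x - q x) ^+ 2 / q x)%:E)%E.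

Definition cube (M : R) : set (Rd R d) :=
  [set x | forall i, Rd_coord x i \in `[- M, M]].

End gaussian_mixture.

(* only meaningful for t > 0 *)
Definition alpha {R : realType} (delta t : R) : R :=
  (2 + delta) / ln (Num.max (ln (1 / t)) (expR 1)).

(* Main.v *)
Require Import Defs.
From mathcomp Require Import all_boot all_order all_algebra.
From mathcomp Require Import all_classical all_reals all_analysis.
From mathcomp Require Import measurable_realfun.
From mathcomp Require Import ring lra zify.

(* Write t for the total variation distance and mu = P - Q. Since phi(x - s)
   phi(x - t) / phi(x) integrates to exp <s, t>, the integral of (f - g)^2 /
   phi is the sum over multi-indices k of (int theta^k dmu)^2 / k!, whose part
   of degree > N is super-exponentially small in N. Conversely, integrating f -
   g against a bounded trigonometric function gives |hat mu(xi)| <= C t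
   exp(|xi|^2 / 2) on real frequencies, and hat mu is a polynomial of total
   degree N up to an error of order N^(-N/2) e^(O(N)). Expanding this
   polynomial in Chebyshev polynomials on the box with half-sides sqrt(k_i),
   where exp(|xi|^2 / 2) is balanced by k!, bounds its coefficient of index k,
   that is int theta^k dmu / k!, with a loss of only (5/2)^N. The weight exp(M
   |x|) relating 1 / g to 1 / phi costs e^(o(N)). As 5/2 < e, this gives, for
   every N >= 1, sqrt(chi2(f || g)) <= C e^N (t + N^(-N/2) e^(bN)), and N close
   to (2 + delta / 2) log(1/t) / log log(1/t) concludes. *)

Set Implicit Arguments.
Unset Strict Implicit.
Unset Printing Implicit Defensive.

Import Order.TTheory GRing.Theory Num.Theory.
Import numFieldNormedType.Exports.

Local Open Scope classical_set_scope.
Local Open Scope ring_scope.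

(** * Chebyshev coefficient functionals *)

Section chebyshev.
Context {R : realType}.

(** The exponent [2 + delta] sets a strict budget. A factor e^(cN) in front of t becomes, with N
    near 2 log(1/t) / log log(1/t), an exponent near 2c, so c may not exceed 1. The truncation error
    is far less sensitive: a factor e^(bN) there only shifts log N / 2 by a constant, so any b is
    admissible. The dangerous factor in front of t is exp(|xi|^2 / 2). A common box of half-side
    sqrt(N) would cost e^(dN/2), even for small k. With half-sides sqrt(k_i) the squared cost is
    e^|k|. In (int theta^k dmu)^2 / k!, dividing out the squared scale of the k-th Taylor
    coefficient leaves the factor prod k_i! / k_i^k_i, and k! <= e (k+1) (k/e)^k shows that this
    cancels e^|k| up to a polynomial in N. The margin between 5/2 and e then pays for two things:
    the polynomial factors, and the region where exp(M |x|) is replaced by a constant e^a with a a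
    small multiple of N. *)

Fixpoint chebyshev (n : nat) : {poly R} :=
  match n with
  | 0 => 1
  | 1 => 'X
  | (m.+1 as n').+1 => 'X * chebyshev n' *+ 2 - chebyshev m
  end.

Lemma chebyshevSS n :
  chebyshev n.+2 = 'X * chebyshev n.+1 *+ 2 - chebyshev n.
Proof. by []. Qed.

Lemma horner_chebyshev n (x : R) : (chebyshev n).[cos x] = cos (n%:R * x).
Proof.
suff: (chebyshev n).[cos x] = cos (n%:R * x) /\
      (chebyshev n.+1).[cos x] = cos (n.+1%:R * x) by case.
elim: n => [|n [IH0 IH1]]; first by rewrite /= hornerC hornerX mul0r cos0 mul1r.
split=> //; rewrite chebyshevSS !hornerE IH1 IH0.
have -> : n.+2%:R * x = n.+1%:R * x + x by rewrite -[n.+2%:R]natr1; ring.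
have -> : n%:R * x = n.+1%:R * x - x by rewrite -[n.+1%:R]natr1; ring.
by rewrite cosB cosD; ring.
Qed.

(* The growth rate of the coefficients is 1 + sqrt 2. All that matters below is
   that 5/2 exceeds it and is less than e. *)
Lemma coef_chebyshev_le n j : `|(chebyshev n)`_j| <= (5 / 2) ^+ n.
Proof.
suff: (forall j, `|(chebyshev n)`_j| <= (5 / 2) ^+ n) /\
      (forall j, `|(chebyshev n.+1)`_j| <= (5 / 2) ^+ n.+1) by case.
elim: n {j} => [|n [IH0 IH1]]; first split=> j.
- by rewrite /= coefC expr0; case: j => [|j] /=; rewrite ?normr1 ?normr0 ?ler01.
- by rewrite /= coefX expr1; case: (j == 1%N); rewrite ?normr1 ?normr0; lra.
split=> // j; rewrite chebyshevSS coefB coefMn coefXM.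
set a := (if _ then _ else _).
have ha : `|a| <= (5 / 2) ^+ n.+1.
  by rewrite /a; case: ifP => _ //; rewrite normr0 exprn_ge0//; lra.
apply: le_trans (ler_normB _ _) _; rewrite normrMn.
have := IH0 j; move: ha; rewrite !exprS.
have : 0 <= (5 / 2 : R) ^+ n by rewrite exprn_ge0//; lra.
lra.
Qed.

Definition cheb_span n (p : {poly R}) :=
  exists b : nat -> R, p = \sum_(m < n) b m *: chebyshev m.

Lemma cheb_spanD n p q : cheb_span n p -> cheb_span n q -> cheb_span n (p + q).
Proof.
move=> [b ->] [c ->]; exists (fun m => b m + c m).
by rewrite -big_split; apply: eq_bigr => i _; rewrite scalerDl.
Qed.

Lemma cheb_spanZ n a p : cheb_span n p -> cheb_span n (a *: p).
Proof.
move=> [b ->]; exists (fun m => a * b m).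
by rewrite scaler_sumr; apply: eq_bigr => i _; rewrite scalerA.
Qed.

Lemma cheb_span_chebyshev n m : (m < n)%N -> cheb_span n (chebyshev m).
Proof.
move=> mn; exists (fun k => (k == m)%:R).
rewrite (bigD1 (Ordinal mn)) //= eqxx scale1r big1 ?addr0// => i im.
by move: im; rewrite -val_eqE /= => /negbTE ->; rewrite scale0r.
Qed.

Lemma cheb_span_sum n k (F : 'I_k -> {poly R}) :
  (forall i, cheb_span n (F i)) -> cheb_span n (\sum_i F i).
Proof.
move=> h; apply: big_ind => //; last exact: cheb_spanD.
by exists (fun=> 0); rewrite big1// => i _; rewrite scale0r.
Qed.

(** By the recurrence, multiplication by 'X sends the polynomial of index m+1 to the half-sum of its
    two neighbours, so the largest index grows by one at each step. *)
Lemma cheb_spanXn k : cheb_span k.+1 'X^k.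
Proof.
elim: k => [|k [b kE]].
  by rewrite expr0; exact: (@cheb_span_chebyshev 1 0).
rewrite exprS kE mulr_sumr; apply: cheb_span_sum => -[m mk] /=.
rewrite -scalerAr; apply: cheb_spanZ.
case: m mk => [|m] mk; first by rewrite mulr1;
  exact: (@cheb_span_chebyshev _ 1).
have -> : 'X * chebyshev m.+1 = 2^-1 *: chebyshev m.+2 + 2^-1 *: chebyshev m.
  rewrite chebyshevSS scalerBr subrK -[(_ * _) *+ 2]scaler_nat scalerA mulVf
    ?scale1r//.
by apply: cheb_spanD; apply: cheb_spanZ; apply: cheb_span_chebyshev; lia.
Qed.

(** Multiplied by the sine of half the angular step, the sum telescopes, and its two end terms agree
    because their arguments differ by j full turns. The bounds on j put the half-step in (0, pi),
    where the sine is nonzero. *)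
Lemma sum_cos_roots K j : (0 < j < K)%N ->
  \sum_(a < K) cos (j%:R * (a%:R * (pi *+ 2 / K%:R))) = 0 :> R.
Proof.
move=> /andP[j0 jK]; have K0 : (K%:R : R) != 0 by rewrite pnatr_eq0; lia.
pose y : R := j%:R * (pi / K%:R).
have siny : sin y != 0.
  rewrite gt_eqF// sin_gt0_pi// /y mulr_gt0 ?divr_gt0 ?pi_gt0 ?ltr0n//=;
    last lia.
  rewrite mulrCA gtr_pMr ?pi_gt0// ltr_pdivrMr ?mul1r ?ltr_nat// ltr0n; lia.
apply: (mulIf siny); rewrite mul0r mulr_suml.
have tel a : cos (j%:R * (a%:R * (pi *+ 2 / K%:R))) * sin y =
    2^-1 * sin (a.+1%:R * (y *+ 2) - y) - 2^-1 * sin (a%:R * (y *+ 2) - y).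
  have -> : j%:R * (a%:R * (pi *+ 2 / K%:R)) = a%:R * (y *+ 2).
    by rewrite /y; field.
  have -> : a.+1%:R * (y *+ 2) - y = a%:R * (y *+ 2) + y.
    by rewrite -natr1; ring.
  by rewrite sinD sinB; field.
rewrite (eq_bigr _ (fun (a : 'I_K) _ => tel a)).
rewrite -(big_mkord xpredT (fun a => 2^-1 * sin (a.+1%:R * (y *+ 2) - y)
  - 2^-1 * sin (a%:R * (y *+ 2) - y))) telescope_sumr//.
have -> : K%:R * (y *+ 2) - y = - y + pi *+ 2 *+ j.
  by rewrite /y -mulr_natr; field.
by rewrite (periodicn (@sinD2pi R)) mul0r sub0r subrr.
Qed.

Section dual.
Variable N : nat.
Let K := (2 * N).+1.
Let phi (a : 'I_K) : R := a%:R * (pi *+ 2 / K%:R).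

Definition cheb_node (a : 'I_K) : R := cos (phi a).

(** A discrete cosine transform: summed against the values of a polynomial of degree at most N at
    the nodes, it returns its n-th Chebyshev coefficient. Taking [K = 2N+1] points prevents
    aliasing, since a product of two such polynomials has frequencies at most 2N. *)
Definition cheb_weight (n : nat) (a : 'I_K) : R :=
  (if n == 0 then 1 else 2) / K%:R * cos (n%:R * phi a).

Lemma cheb_node_le1 a : `|cheb_node a| <= 1.
Proof. exact: cos_max. Qed.

Lemma sum_cheb_weight n : \sum_a `|cheb_weight n a| <= 2.
Proof.
have K0 : (0 : R) < K%:R by rewrite ltr0n.
apply: (@le_trans _ _ (\sum_(a < K) 2 / K%:R)).
  apply: ler_sum => a _; rewrite /cheb_weight normrM.
  rewrite -[leRHS]mulr1 ler_pM ?normr_ge0 ?cos_max// ger0_norm.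
    by rewrite ler_pM2r ?invr_gt0//; case: ifP => _ //; lra.
  by rewrite divr_ge0 ?(ltW K0)//; case: ifP.
by rewrite sumr_const card_ord -[(_ / _) *+ _]mulr_natr divfK ?lt0r_neq0.
Qed.

(** A product of cosines splits into the frequencies m + n and |m - n|, the latter written with
    truncated subtractions. Both are below K, so [sum_cos_roots] kills each one that is nonzero. *)
Lemma cheb_dual_chebyshev m n : (m <= N)%N -> (n <= N)%N ->
  \sum_a cheb_weight n a * (chebyshev m).[cheb_node a] = (n == m)%:R.
Proof.
move=> mN nN; have K0 : (K%:R : R) != 0 by rewrite pnatr_eq0.
have S0 j : (j < K)%N -> \sum_(a < K) cos (j%:R * phi a) = (j == 0)%:R * K%:R.
  case: j => [_|j jK]; last by rewrite sum_cos_roots ?jK ?mul0r.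
  rewrite (eq_bigr (fun=> 1)); last by move=> a _; rewrite mul0r cos0.
  by rewrite sumr_const card_ord mul1r.
rewrite (eq_bigr (fun a => (if n == 0 then 1 else 2) / K%:R *
    (2^-1 * (cos ((m + n)%:R * phi a) +
      cos (((m - n) + (n - m))%N%:R * phi a)))));
    last first.
  move=> a _; rewrite horner_chebyshev -[LHS]mulrA; congr (_ * _).
  have -> : cos (((m - n) + (n - m))%N%:R * phi a) =
    cos (m%:R * phi a - n%:R * phi a).
    have [nm|/ltnW mn] := leqP n m.
      by rewrite (eqP nm) addn0 natrB//; congr cos; ring.
    by rewrite (eqP mn) add0n natrB// -cosN; congr cos; ring.
  by rewrite natrD mulrDl cosB cosD; field.
rewrite -mulr_sumr -mulr_sumr big_split /= !S0; try by rewrite /K; lia.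
have -> : (((m - n) + (n - m))%N == 0%N) = (n == m) by lia.
have [->|nm] := eqVneq n m.
  rewrite addn_eq0 andbb; case: (m == 0%N) => /=; by field.
have -> : (m + n == 0)%N = false by lia.
by rewrite !mul0r addr0 !mulr0.
Qed.

(** 'X^k has no Chebyshev component of index n. This is why the restriction on total degree in
    [tensor_weight] loses nothing. *)
Lemma cheb_dual_pow_lt k n : (k < n <= N)%N ->
  \sum_a cheb_weight n a * cheb_node a ^+ k = 0.
Proof.
move=> /andP[kn nN]; have [b kE] := cheb_spanXn k.
rewrite (eq_bigr (fun a => \sum_(m < k.+1)
   b m * (cheb_weight n a * (chebyshev m).[cheb_node a]))); last first.
  move=> a _; rewrite -hornerXn kE horner_sum mulr_sumr.
  by apply: eq_bigr => m _; rewrite hornerZ mulrCA.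
rewrite exchange_big big1//= => -[m mk] _ /=.
by rewrite -mulr_sumr cheb_dual_chebyshev//;
  [case: eqP; [lia|rewrite mulr0]|lia].
Qed.

(** The inner sum is the n-th Chebyshev coefficient of 'X^k. Summing against the j-th coefficients
    of the Chebyshev polynomials reassembles 'X^k and reads off its j-th coefficient. *)
Lemma cheb_dual_pow j k : (k <= N)%N ->
  \sum_(n < N.+1) (chebyshev n)`_j * \sum_a cheb_weight n a * cheb_node a ^+ k
  = (j == k)%:R.
Proof.
move=> kN; have [b kE] := cheb_spanXn k.
have tau (n : 'I_N.+1) : \sum_a cheb_weight n a * cheb_node a ^+ k =
    \sum_(m < k.+1) b m * (n == m :> nat)%:R.
  rewrite (eq_bigr (fun a => \sum_(m < k.+1)
     b m * (cheb_weight n a * (chebyshev m).[cheb_node a]))); last first.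
    move=> a _; rewrite -hornerXn kE horner_sum mulr_sumr.
    by apply: eq_bigr => m _; rewrite hornerZ mulrCA.
  rewrite exchange_big; apply: eq_bigr => -[m mk] _ /=.
  by rewrite -mulr_sumr cheb_dual_chebyshev//; [lia|have := ltn_ord n; lia].
under eq_bigr do rewrite tau mulr_sumr.
rewrite exchange_big -coefXn kE coef_sum; apply: eq_bigr => -[m mk] _ /=.
have mN : (m < N.+1)%N by lia.
rewrite (bigD1 (Ordinal mN)) //= eqxx mulr1 coefZ mulrC big1 ?addr0// => i im.
by move: im; rewrite -val_eqE /= => /negbTE ->; rewrite !mulr0.
Qed.

End dual.
End chebyshev.

(** * Coefficient functionals in several variables *)

Section tensor_dual.
Context {R : realType}.
Variables (d N : nat).
Local Notation node := (@cheb_node R N).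
Local Notation weight := (@cheb_weight R N).

(* Only products of total degree <= N are kept; all of the degrees <= N in each
   variable would cost (5/2)^(dN) instead of (5/2)^N in sum_tensor_weight. *)
Definition tensor_weight (k : 'I_d -> nat) (a : {ffun 'I_d -> 'I_(2 * N).+1})
  : R :=
  \sum_(n : {ffun 'I_d -> 'I_N.+1} | (\sum_i n i <= N)%N)
    \prod_i ((chebyshev (n i))`_(k i) * weight (n i) (a i)).

Lemma tensor_weight_dual (k l : 'I_d -> nat) : (\sum_i l i <= N)%N ->
  \sum_a tensor_weight k a * \prod_i node (a i) ^+ l i =
  \prod_i (k i == l i)%:R.
Proof.
move=> lN; have liN i : (l i <= N)%N.
  by apply: leq_trans lN; rewrite (bigD1 i)//= leq_addr.
rewrite /tensor_weight. under [LHS]eq_bigr do rewrite mulr_suml.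
rewrite exchange_big /=.
under [LHS]eq_bigr => n _.
  under eq_bigr do rewrite -big_split /=.
  rewrite -(bigA_distr_bigA (fun i b =>
    (chebyshev (n i))`_(k i) * weight (n i) b * node b ^+ l i)).
  over.
(* The restriction on total degree is lifted so that the sum factors over coordinates. An added
   index n has total degree above N, hence [l i < n i] for some i, and that factor vanishes by
   [cheb_dual_pow_lt]. *)
rewrite [LHS](_ : _ = \sum_(n : {ffun 'I_d -> 'I_N.+1}) \prod_i \sum_b
   ((chebyshev (n i))`_(k i) * weight (n i) b * node b ^+ l i)); last first.
  apply/esym; rewrite (bigID (fun n : {ffun 'I_d -> 'I_N.+1} =>
    (\sum_i n i <= N)%N)) /=.
  rewrite [X in _ + X]big1 ?addr0// => n nN.
  have [i lin] : exists i, (l i < n i)%N.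
    apply/existsP; apply: contraNT nN => /existsPn h.
    by apply: leq_trans lN; apply: leq_sum => i _; rewrite leqNgt h.
  rewrite (bigD1 i) //=; apply/eqP; rewrite mulf_eq0; apply/orP; left;
    apply/eqP.
  under eq_bigr do rewrite -(mulrA (polyseq _)`_ _).
  by rewrite -mulr_sumr cheb_dual_pow_lt ?mulr0 // lin -ltnS ltn_ord.
rewrite -(bigA_distr_bigA (fun i (n : 'I_N.+1) => \sum_b
   ((chebyshev n)`_(k i) * weight n b * node b ^+ l i))).
apply: eq_bigr => i _; rewrite -(cheb_dual_pow (k i) (liN i)).
by apply: eq_bigr => n _; rewrite mulr_sumr; apply: eq_bigr => b _;
  rewrite [RHS]mulrA.
Qed.

(** Each index n contributes at most 2 per coordinate from the weights and (5/2)^(n_1 + ... + n_d)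
    <= (5/2)^N from the coefficients. There are at most (N+1)^d indices. *)
Lemma sum_tensor_weight (k : 'I_d -> nat) :
  \sum_a `|tensor_weight k a| <= N.+1%:R ^+ d * 2 ^+ d * (5 / 2) ^+ N.
Proof.
have c1 : 1 <= (5 / 2 : R) by lra.
have c0 : 0 <= (5 / 2 : R) by lra.
apply: (@le_trans _ _ (\sum_(n : {ffun 'I_d -> 'I_N.+1} | (\sum_i n i <= N)%N)
    \prod_i \sum_b `|(chebyshev (n i))`_(k i) * weight (n i) b|)).
  under [leRHS]eq_bigr => n _.
    rewrite (bigA_distr_bigA (fun i b => `|(chebyshev (n i))`_(k i) * weight
      (n i) b|)).
    over.
  rewrite exchange_big; apply: ler_sum => a _.
  apply: le_trans (ler_norm_sum _ _ _) _.
  by apply: ler_sum => n _; rewrite normr_prod.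
apply: (@le_trans _ _ (\sum_(n : {ffun 'I_d -> 'I_N.+1} | (\sum_i n i <= N)%N)
    (2 ^+ d * (5 / 2) ^+ N))).
  apply: ler_sum => n nN.
  apply: (@le_trans _ _ (\prod_i (2 * (5 / 2) ^+ n i))).
    apply: ler_prod => i _; apply/andP; split; first by apply: sumr_ge0 => ? _;
      exact: normr_ge0.
    under eq_bigr do rewrite normrM.
    rewrite -mulr_sumr mulrC ler_pM ?normr_ge0 ?coef_chebyshev_le
      ?sum_cheb_weight//.
    by apply: sumr_ge0 => ? _; exact: normr_ge0.
  rewrite big_split /= prodr_const card_ord prodrXr ler_wpM2l ?exprn_ge0//.
  by rewrite ler_weXn2l.
rewrite sumr_const -[leLHS]mulr_natl -mulrA ler_wpM2r ?mulr_ge0 ?exprn_ge0//.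
by rewrite -natrX ler_nat (leq_trans (max_card _))// card_ffun !card_ord.
Qed.

End tensor_dual.

(** * Truncated Taylor expansions of products *)

Section taylor.
Context {R : realType}.
Implicit Types (e : nat -> R) (u rho : R).

Lemma sum_exp_coeff_le (x : R) n : 0 <= x -> \sum_(l < n) x ^+ l / l`!%:R <=
  expR x.
Proof.
move=> x0; rewrite -(big_mkord xpredT (fun l => x ^+ l / l`!%:R)).
apply: (@nondecreasing_cvgn_le _ (series (exp_coeff x)));
  last exact: is_cvg_series_exp_coeff.
move=> a b ab; apply: nondecreasing_series ab => k _ _.
by rewrite /exp_coeff /= divr_ge0 ?exprn_ge0.
Qed.

(** Every tail term has index l >= n, so rho^n <= rho^l: the tail and the head fit together into the
    single series of [expR (rho * |u|)]. The joint form is what lets the product over coordinates in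
    [prod_taylor] stay an exponential, without a factor per coordinate. *)
Lemma series_tail e S u rho n : (forall l, `|e l| <= 1) -> 1 <= rho ->
  series (fun l => e l * (u ^+ l / l`!%:R)) @ \oo --> S ->
  `|S - \sum_(l < n) e l * (u ^+ l / l`!%:R)| * rho ^+ n +
    \sum_(l < n) (rho * `|u|) ^+ l / l`!%:R <= expR (rho * `|u|).
Proof.
move=> e1 rho1 eS; have rho0 : 0 <= rho by rewrite (le_trans _ rho1).
rewrite -(big_mkord xpredT (fun l => e l * (u ^+ l / l`!%:R))).
rewrite -(big_mkord xpredT (fun l => (rho * `|u|) ^+ l / l`!%:R)).
set a := (fun l => e l * _) in eS *;
  set b := (fun l : nat => (rho * `|u|) ^+ l / l`!%:R).
have cvgS : `|series a m - series a n| * rho ^+ n + series b n @[m --> \oo] -->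
    `|S - series a n| * rho ^+ n + series b n.
  apply: cvgD; last exact: cvg_cst.
  apply: cvgM; last exact: cvg_cst.
  by apply: cvg_norm; apply: cvgB => //; exact: cvg_cst.
rewrite -(cvg_lim _ cvgS)//; apply: limr_le; first by apply/cvg_ex; eexists;
  exact: cvgS.
exists n => // m /= nm; apply: le_trans (_ : series b m <= _); last first.
  rewrite /series /= big_mkord; apply: sum_exp_coeff_le; exact: mulr_ge0.
rewrite -lerBrDr !sub_series nm.
apply: le_trans (ler_wpM2r _ (ler_norm_sum _ _ _)) _; first exact: exprn_ge0.
rewrite mulr_suml big_nat_cond [leRHS]big_nat_cond; apply: ler_sum =>
  l /andP[/andP[nl lm] _].
rewrite /a /b normrM normf_div normrX (ger0_norm (ler0n _ _)) exprMn.
apply: (@le_trans _ _ (1 * (`|u| ^+ l / l`!%:R) * rho ^+ l)).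
  apply: ler_pM; rewrite ?mulr_ge0 ?exprn_ge0 ?invr_ge0//.
    by rewrite ler_wpM2r// divr_ge0 ?exprn_ge0.
  by rewrite ler_weXn2l.
by rewrite mul1r mulrC mulrA.
Qed.

Variables (d N : nat).

(* Each factor is expanded into its N+1 first terms plus a remainder, which is
   given the index N.+1; every index k of total degree > N is then charged rho
   ^ (|k| - N - 1). *)
Lemma prod_taylor e (S u : 'I_d -> R) rho :
  (forall l, `|e l| <= 1) -> 1 <= rho ->
  (forall i, series (fun l => e l * (u i ^+ l / l`!%:R)) @ \oo --> S i) ->
  `|\prod_i S i - \sum_(k : {ffun 'I_d -> 'I_N.+2} | (\sum_i k i <= N)%N)
       \prod_i (e (k i) * (u i ^+ k i / (k i)`!%:R))| <=
  rho ^- N.+1 * expR (rho * \sum_i `|u i|).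
Proof.
move=> e1 rho1 eS; have rho0 : 0 < rho by rewrite (lt_le_trans _ rho1).
pose mon i (l : nat) := e l * (u i ^+ l / l`!%:R).
pose t i (l : nat) := if (l < N.+1)%N then mon i l
  else S i - \sum_(j < N.+1) mon i j.
have SE i : S i = \sum_(l < N.+2) t i l.
  rewrite big_ord_recr/= {2}/t ltnn addrC.
  rewrite [X in _ + X](_ : _ = \sum_(j < N.+1) mon i j) ?subrK//.
  by apply: eq_bigr => l _; rewrite /t ltn_ord.
under eq_bigr do rewrite SE.
rewrite bigA_distr_bigA /=
  (bigID (fun k : {ffun 'I_d -> 'I_N.+2} => (\sum_i k i <= N)%N)) /=.
have -> (f : {ffun 'I_d -> 'I_N.+2} -> R) (g : {ffun 'I_d -> 'I_N.+2} -> R)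
  (P : pred _) x :
  (forall k, P k -> f k = g k) -> \sum_(k | P k) f k + x - \sum_(k | P k) g k =
    x.
  by move=> fg; rewrite addrAC (eq_bigr _ fg) subrr add0r.
  apply: le_trans (ler_norm_sum _ _ _) _.
  rewrite ler_pdivlMl ?exprn_gt0// mulr_sumr.
  apply: (@le_trans _ _ (\sum_(k : {ffun 'I_d -> 'I_N.+2})
      \prod_i (`|t i (k i)| * rho ^+ k i))).
    rewrite [leRHS](bigID (fun k : {ffun 'I_d -> 'I_N.+2} =>
      (\sum_i k i <= N)%N)) /=.
    rewrite -[leLHS]add0r lerD//.
      apply: sumr_ge0 => k _; apply: prodr_ge0 => i _.
      by rewrite mulr_ge0 ?exprn_ge0// ltW.
    apply: ler_sum => k; rewrite -ltnNge => Nk.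
    rewrite normr_prod big_split /= mulrC ler_wpM2l ?prodr_ge0//.
    by rewrite prodrXr ler_weXn2l.
  rewrite -(bigA_distr_bigA (fun i (l : 'I_N.+2) => `|t i l| * rho ^+ l)).
  rewrite mulr_sumr expR_sum; apply: ler_prod => i _; apply/andP; split.
    by apply: sumr_ge0 => l _; rewrite mulr_ge0 ?exprn_ge0// ltW.
  apply: le_trans (series_tail N.+1 e1 rho1 (eS i)).
  rewrite big_ord_recr /= {2}/t ltnn addrC lerD2l.
  apply: ler_sum => l _; rewrite /t ltn_ord exprMn -mulrA mulrC.
  rewrite ler_wpM2l ?exprn_ge0 ?(ltW rho0)//.
  rewrite /mon normrM normf_div normrX (ger0_norm (ler0n _ _)).
  by rewrite -[leRHS]mul1r ler_wpM2r// divr_ge0 ?exprn_ge0.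
move=> k kN; apply: eq_bigr => i _; rewrite /t; case: ifPn => //.
have : (k i <= N)%N by apply: leq_trans kN; rewrite (bigD1 i)//= leq_addr.
by rewrite ltnS => ->.
Qed.

(** The signs +, +, -, - repeated, in the shape that matches the cosine and sine series term by
    term. Since none vanishes, moments of every index can be recovered. *)
Definition cas_coeff (l : nat) : R :=
  (~~ odd l)%:R * (-1) ^+ l./2 + (odd l)%:R * (-1) ^+ l.-1./2.

Lemma norm_cas_coeff l : `|cas_coeff l| = 1.
Proof.
rewrite /cas_coeff; case: (odd l) => /=.
  by rewrite mul0r add0r mul1r normrX normrN1 expr1n.
by rewrite mul0r addr0 mul1r normrX normrN1 expr1n.
Qed.

(* cos + sin has no vanishing Taylor coefficient, and convolving with a
   Gaussian density multiplies it by a scalar (integral_gauss1_cas). *)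
Definition cas (x : R) : R := cos x + sin x.

Lemma cvg_cas (x : R) : series (fun l => cas_coeff l * (x ^+ l / l`!%:R)) @ \oo
  --> cas x.
Proof.
rewrite [X in X @ _ -->
  _](_ : _ = (series (cos_coeff x) \+ series (sin_coeff x) : nat -> R)%R).
  apply: cvgD.
    by rewrite cos.unlock; exact: is_cvg_series_cos_coeff.
  by rewrite sin.unlock; exact: is_cvg_series_sin_coeff.
apply/funext => n /=; rewrite /series/= -big_split; apply: eq_bigr => l _ /=.
by rewrite /cas_coeff mulrDl !mulrA.
Qed.

Lemma cvg_exp (x : R) : series (fun l => 1 * (x ^+ l / l`!%:R)) @ \oo -->
  expR x.
Proof.
under [X in series X]eq_fun do rewrite mul1r.
exact: is_cvg_series_exp_coeff.
Qed.

Lemma norm_cas_le (x : R) : `|cas x| <= 2.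
Proof.
apply: le_trans (ler_normD _ _) _.
by have := cos_max x; have := sin_max x; lra.
Qed.

End taylor.

(** * One-dimensional Gaussian integrals *)

Section gauss1.
Context {R : realType}.
Notation mu := (@lebesgue_measure R).

Lemma integral_translate (G : R -> R) (c : R) : continuous G ->
  (forall x, 0 <= G x) ->
  (\int[mu]_x (G (x + c))%:E = \int[mu]_x (G x)%:E)%E.
Proof.
move=> cG G0; pose F (x : R) : R := x + c.
have F'E : (F : R^o -> R^o)^`()%classic = cst 1.
  apply/funext => x; rewrite derive1E /F.
  by rewrite deriveD// derive_id derive_cst addr0.
rewrite [RHS](@increasing_ge0_integration_by_substitutionT R F G).
- by apply: eq_integral => x _; rewrite F'E /= mulr1.
- by move=> x y xy; rewrite /F ltrD2r.
- by rewrite F'E => ?; exact: cvg_cst.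
- by rewrite F'E; exact: is_cvg_cst.
- by rewrite F'E; exact: is_cvg_cst.
- by move=> x; rewrite /F; exact: derivableD.
- exact: cvg_addrr_Ny.
- exact: cvg_addrr.
- by [].
- by [].
Qed.

Definition gauss1 (x : R) : R := (Num.sqrt (2 * pi))^-1 * expR (- (x ^+ 2 / 2)).

Lemma gauss1_ge0 x : 0 <= gauss1 x.
Proof. by rewrite mulr_ge0 ?invr_ge0 ?sqrtr_ge0 ?expR_ge0. Qed.

Lemma gauss1_gt0 x : 0 < gauss1 x.
Proof. by rewrite mulr_gt0 ?invr_gt0 ?sqrtr_gt0 ?expR_gt0 ?mulr_gt0 ?pi_gt0.
  Qed.

Lemma gauss1_shift m : (fun x => gauss1 (x - m)) = normal_pdf m 1.
Proof.
rewrite normal_pdfE ?oner_eq0//; apply/funext => x.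
rewrite /gauss1 /normal_peak /normal_fun expr1n mul1r mulr_natl.
by rewrite mulNr.
Qed.

Lemma continuous_gauss1 : continuous gauss1.
Proof.
have := gauss1_shift 0; under [X in X = _]eq_fun do rewrite subr0.
by rewrite (_ : (fun x => gauss1 x) = gauss1)// => ->;
  apply: continuous_normal_pdf; rewrite oner_eq0.
Qed.

Lemma measurable_gauss1 : measurable_fun setT gauss1.
Proof. exact: continuous_measurable_fun continuous_gauss1. Qed.

Lemma integral_gauss1 m : (\int[mu]_x (gauss1 (x - m))%:E = 1)%E.
Proof.
rewrite -(integral_normal_pdf m 1); apply: eq_integral => x _.
by rewrite -gauss1_shift.
Qed.

Lemma integrable_gauss1 m : mu.-integrable setT (fun x => (gauss1 (x - m))%:E).
Proof.
have := integrable_normal_pdf m (1 : R).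
by rewrite -gauss1_shift.
Qed.

Lemma continuous_cas : continuous (@cas R).
Proof. by move=> x; apply: cvgD; [exact: continuous_cos|exact: continuous_sin].
  Qed.

Lemma casD (a b : R) : cas (a + b) = cos b * cas a + sin b * cas (- a).
Proof. by rewrite /cas cosD sinD cosN sinN; ring. Qed.

Global Instance is_derive_cas (x : R) : is_derive x 1 (@cas R) (cas (- x)).
Proof.
rewrite /cas; apply: is_derive_eq.
by rewrite cosN sinN addrC.
Qed.

Lemma integrable_gauss1_cas m r c :
  mu.-integrable setT (fun x => (gauss1 (x - m) * cas (r * x + c))%:E).
Proof.
apply: (@le_integrable _ _ _ mu setT (@measurableT _ (measurableTypeR R)) _
  (fun x => ((2%:E) * (gauss1 (x - m))%:E)%E)); last 1 first.
- by apply: integrableZl => //; exact: integrable_gauss1.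
- apply/measurable_EFinP; apply: continuous_measurable_fun => x.
  apply: cvgM; last first.
    apply: (@continuous_comp _ _ _ (fun x => r * x + c) cas);
      last exact: continuous_cas.
    by apply: cvgD; [apply: cvgM;
      [exact: cvg_cst|exact: cvg_id]|exact: cvg_cst].
  apply: (@continuous_comp _ _ _ (fun x => x - m) gauss1);
    last exact: continuous_gauss1.
  by apply: cvgB; [exact: cvg_id|exact: cvg_cst].
move=> x _; rewrite -EFinM /= !lee_fin normrM ger0_norm ?gauss1_ge0//.
rewrite (ger0_norm (_ : 0 <= 2 * gauss1 (x - m))) ?mulr_ge0 ?gauss1_ge0//.
by rewrite mulrC ler_wpM2r ?gauss1_ge0// norm_cas_le.
Qed.

Lemma gauss1_cas_translate m r c :
  \int[mu]_x (gauss1 (x - m) * cas (r * x + c)) =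
  \int[mu]_x (gauss1 x * cas (r * x + (r * m + c))).
Proof.
(* [integral_translate] requires a nonnegative integrand. As |cas| <= 2, adding 2 ensures this, and
   the extra mass 2 is the same on both sides. *)
have key : \int[mu]_x (gauss1 (x - m) * (cas (r * x + c) + 2)) =
  \int[mu]_x (gauss1 x * (cas (r * x + (r * m + c)) + 2)).
  rewrite /Rintegral; congr fine.
  pose G x := gauss1 (x - m) * (cas (r * x + c) + 2).
  rewrite -(@integral_translate G m).
  - apply: eq_integral => x _; rewrite /G addrK.
    by congr (_ * (cas _ + _))%:E; ring.
  - move=> x; apply: cvgM; last first.
      apply: cvgD; last exact: cvg_cst.
      apply: (@continuous_comp _ _ _ (fun x => r * x + c) cas);
        last exact: continuous_cas.
      by apply: cvgD; [apply: cvgM;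
        [exact: cvg_cst|exact: cvg_id]|exact: cvg_cst].
    apply: (@continuous_comp _ _ _ (fun x => x - m) gauss1);
      last exact: continuous_gauss1.
    by apply: cvgB; [exact: cvg_id|exact: cvg_cst].
  - move=> x; rewrite mulr_ge0 ?gauss1_ge0//.
    by have := norm_cas_le (r * x + c); rewrite ler_norml; lra.
have split2 k q b : \int[mu]_x (gauss1 (x - k) * (cas (q * x + b) + 2)) =
    \int[mu]_x (gauss1 (x - k) * cas (q * x + b)) + 2.
  under eq_Rintegral do rewrite mulrDr.
  have i2 : mu.-integrable setT (EFin \o (fun x => gauss1 (x - k) * 2)).
    under [X in _ _ _ X]eq_fun do rewrite /= EFinM; apply: integrableZr => //.
    exact: integrable_gauss1.
  rewrite RintegralD//; last exact: integrable_gauss1_cas.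
  congr (_ + _); rewrite RintegralZr//; last exact: integrable_gauss1.
  by rewrite /Rintegral integral_gauss1 mul1r.
have split0 q b : \int[mu]_x (gauss1 x * (cas (q * x + b) + 2)) =
    \int[mu]_x (gauss1 x * cas (q * x + b)) + 2.
  have := split2 0 q b; under eq_Rintegral do rewrite subr0.
  by under [X in _ = X + _]eq_Rintegral do rewrite subr0.
by move: key; rewrite split2 split0 => /addIr.
Qed.
End gauss1.

(** * The Gaussian integral of [cas] *)

Section gauss_cas.
Context {R : realType}.
Notation mu := (@lebesgue_measure R).

(** A majorant, uniform over shifts |s| <= 1, for both differentiations under the integral. With u =
    x - s, |u| <= e^(u^2/4) leaves e^(-u^2/4), and (x - 2s)^2 >= 0 gives u^2/4 >= x^2/8 - 1/4. The
    factor 2 bounds [cas]. *)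
Let G (x : R) : R :=
  2 * ((Num.sqrt (2 * pi))^-1 * (expR (4^-1) * expR (- (x ^+ 2 / 8)))).

Let G_ge0 x : 0 <= G x.
Proof. by rewrite /G !mulr_ge0 ?expR_ge0 ?invr_ge0 ?sqrtr_ge0. Qed.

Let integrable_G : mu.-integrable setT (EFin \o G).
Proof.
rewrite [X in _ _ _ X](_ : _ =
  (fun x => (2 * ((Num.sqrt (2 * pi))^-1 * expR 4^-1)
   / normal_peak 2)%:E * (normal_pdf 0 2 x)%:E)%E).
  by apply: integrableZl => //; exact: integrable_normal_pdf.
apply/funext => x; rewrite /= -EFinM normal_pdfE ?pnatr_eq0//; congr EFin;
  rewrite [RHS]mulrA divfK; last first.
  by rewrite gt_eqF// normal_peak_gt0 ?pnatr_eq0.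
rewrite /G /normal_fun subr0 mulNr.
have -> : (2 ^+ 2 *+ 2 : R) = 8 by ring.
by rewrite !mulrA.
Qed.

Let G_ub (s x y : R) : `|s| <= 1 -> `|y| <= 2 ->
  `|(x - s) * gauss1 (x - s) * y| <= G x.
Proof.
move=> s1 y2; rewrite normrM mulrC /G ler_pM// normrM
  (ger0_norm (gauss1_ge0 _)).
rewrite /gauss1 mulrCA ler_wpM2l ?invr_ge0 ?sqrtr_ge0//.
set u := x - s.
have : `|u| <= expR (u ^+ 2 / 4).
  apply: le_trans (expR_ge1Dx _).
  rewrite -subr_ge0 -(real_normK (num_real u)).
  have -> : 1 + `|u| ^+ 2 / 4 - `|u| = (1 - `|u| / 2) ^+ 2 by field.
  exact: sqr_ge0.
move=> /(ler_wpM2r (expR_ge0 (- (u ^+ 2 / 2)))) /le_trans; apply.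
rewrite -!expRD ler_expR.
have : s ^+ 2 <= 1 by rewrite -(real_normK (num_real s)) expr_le1.
have : 0 <= (x - 2 * s) ^+ 2 by rewrite sqr_ge0.
rewrite /u; nra.
Qed.

Definition gauss_cas_int (r : R) : R := \int[mu]_x (gauss1 x * cas (r * x)).
Local Notation J := gauss_cas_int.

Let integrable_J r : mu.-integrable setT
  (EFin \o (fun x => gauss1 x * cas (r * x))).
Proof.
have := integrable_gauss1_cas 0 r 0.
by under eq_fun do rewrite subr0 addr0.
Qed.

(* Integration by parts, obtained by differentiating under the integral the
   translation identity gauss1_cas_translate in the shift. *)
Let xJ r : \int[mu]_x (x * gauss1 x * cas (- (r * x))) = - r * J r.
Proof.
pose f (s x : R) := gauss1 (x - s) * cas (- r * x + 0).
have df (s x : R) : is_derive s 1 (f^~ x)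
  ((x - s) * gauss1 (x - s) * cas (- r * x)).
  rewrite /f.
  have h : is_derive s 1 (fun s : R => gauss1 (x - s))
    ((x - s) * gauss1 (x - s)).
    apply: is_derive_eq (is_derive1_comp _ _) _.
    rewrite /GRing.scale /= /gauss1; field.
    by rewrite gt_eqF// sqrtr_gt0 mulr_gt0 ?pi_gt0.
  apply: is_derive_eq.
  by rewrite addr0 /GRing.scale /=; ring.
have d1f (s x : R) : partial1of2 f s x = (x - s) * gauss1 (x - s) * cas
  (- r * x).
  by rewrite partial1of2E; apply: derive_val.
have I0 : `](-1 : R), 1[%classic (0 : R) by rewrite /= in_itv /= ltrN10 ltr01.
(* After translation, [casD] makes the dependence on s explicit, so the derivative at 0 can be read
   off as - r J(r). *)
have FE : (fun s => \int[mu]_x f s x) =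
  (fun s => cos (r * s) * J (- r) - sin (r * s) * J r).
  apply/funext => s; rewrite gauss1_cas_translate.
  transitivity (\int[mu]_x (cos (r * s) * (gauss1 x * cas (- r * x)) -
      sin (r * s) * (gauss1 x * cas (r * x)))).
    apply: eq_Rintegral => x _.
    rewrite addr0 casD mulNr mulNr cosN sinN opprK; ring.
  have iZ c q : mu.-integrable setT
    (EFin \o (fun x => c * (gauss1 x * cas (q * x)))).
    under [X in _ _ _ X]eq_fun do rewrite /= EFinM; apply: integrableZl => //.
    exact: integrable_J.
  rewrite RintegralB//.
  by rewrite !RintegralZl.
have h1 : forall s : R, `](-1 : R),
  1[%classic s -> mu.-integrable setT (EFin \o f s).
  by move=> s _; exact: integrable_gauss1_cas.
have h2 : forall s x : R, `](-1 : R), 1[%classic s -> setT x ->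
  derivable (f^~ x) s 1.
  by move=> s x _ _; apply: ex_derive.
have h3 : forall s x : R, `](-1 : R), 1[%classic s -> setT x ->
  `|partial1of2 f s x| <= G x.
  move=> s x /= ; rewrite in_itv /= => /andP[s1 s2] _; rewrite d1f; apply: G_ub.
    by rewrite ler_norml !ltW.
  exact: norm_cas_le.
transitivity (\int[mu]_x partial1of2 f 0 x).
  by apply: eq_Rintegral => x _; rewrite d1f subr0 mulNr.
rewrite -(@differentiation_under_integral R _ _ mu f setT measurableT 0 _ _ I0
  h1 h2 G G_ge0 integrable_G h3).
rewrite FE derive1E; apply: derive_val.
apply: is_derive_eq.
by rewrite /GRing.scale /= !mulr0 cos0 sin0; ring.
Qed.

(** Differentiating [cas (r * x)] in r produces x cas(- r x), whose integral is [xJ]. This linear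
    equation with J(0) = 1 determines the Gaussian. *)
Let derive_J (r : R) : is_derive r 1 J (- r * J r).
Proof.
pose f (s x : R) := gauss1 x * cas (s * x).
have df (s x : R) : is_derive s 1 (f^~ x) (x * gauss1 x * cas (- (s * x))).
  rewrite /f.
  have h : is_derive s 1 (fun s : R => cas (s * x)) (x * cas (- (s * x))).
    apply: is_derive_eq (is_derive1_comp _ _) _.
    by rewrite /GRing.scale /=; ring.
  apply: is_derive_eq.
  by rewrite /GRing.scale /=; ring.
have d1f (s x : R) : partial1of2 f s x = x * gauss1 x * cas (- (s * x)).
  by rewrite partial1of2E; apply: derive_val.
have I0 : `](r - 1), (r + 1)[%classic r by rewrite /= in_itv /=; apply/andP;
  split; lra.
have h1 : forall s : R, `](r - 1),
  (r + 1)[%classic s -> mu.-integrable setT (EFin \o f s).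
  by move=> s _; exact: integrable_J.
have h2 : forall s x : R, `](r - 1), (r + 1)[%classic s -> setT x ->
  derivable (f^~ x) s 1.
  by move=> s x _ _; apply: ex_derive.
have h3 : forall s x : R, `](r - 1), (r + 1)[%classic s -> setT x ->
  `|partial1of2 f s x| <= G x.
  move=> s x _ _; rewrite d1f -[X in X * gauss1 _]subr0 -[X in gauss1 X]subr0;
    apply: G_ub.
    by rewrite normr0.
  exact: norm_cas_le.
apply: DeriveDef.
  exact: (@derivable_under_integral R _ _ mu f setT measurableT r _ _ I0 h1 h2
    G G_ge0 integrable_G h3).
rewrite -derive1E (@differentiation_under_integral R _ _ mu f setT measurableT
  r _ _ I0 h1 h2 G G_ge0 integrable_G h3).
by rewrite -xJ; apply: eq_Rintegral => x _; rewrite d1f.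
Qed.

Lemma gauss_cas_intE (r : R) : J r = expR (- (r ^+ 2 / 2)).
Proof.
have d0 (x : R) : is_derive x 1 (fun x : R => expR (x ^+ 2 / 2) * J x) 0.
  have h : is_derive x 1 (fun x : R => expR (x ^+ 2 / 2))
    (x * expR (x ^+ 2 / 2)).
    apply: is_derive_eq.
    by rewrite /GRing.scale /=; field.
  have hJ := derive_J x; apply: is_derive_eq.
  by rewrite /GRing.scale /=; ring.
have := is_derive_0_is_cst r 0 d0.
have -> : J 0 = 1.
  rewrite /gauss_cas_int /Rintegral -[RHS]/(fine 1%E)
    -(integral_gauss1 (0 : R)).
  congr fine; apply: eq_integral => x _.
  by rewrite mul0r /cas cos0 sin0 addr0 mulr1 subr0.
rewrite expr0n mul0r expR0 mulr1 => h.
have e0 : expR (r ^+ 2 / 2) != 0 by rewrite gt_eqF ?expR_gt0.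
by apply: (mulfI e0); rewrite h expRN mulfV.
Qed.

(** Translating and expanding by [casD] leaves the integrals at the frequencies r and - r. These are
    equal, so the cosine and the sine of r m recombine into [cas]. *)
Lemma integral_gauss1_cas (m r : R) :
  \int[mu]_x (gauss1 (x - m) * cas (r * x)) = expR (- (r ^+ 2 / 2)) * cas
    (r * m).
Proof.
transitivity (\int[mu]_x (gauss1 (x - m) * cas (r * x + 0))).
  by apply: eq_Rintegral => x _; rewrite addr0.
rewrite gauss1_cas_translate.
transitivity (\int[mu]_x (cos (r * m) * (gauss1 x * cas (r * x)) +
      sin (r * m) * (gauss1 x * cas (- r * x)))).
  by apply: eq_Rintegral => x _; rewrite addr0 casD mulNr; ring.
have iZ c q : mu.-integrable setT
  (EFin \o (fun x => c * (gauss1 x * cas (q * x)))).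
  under [X in _ _ _ X]eq_fun do rewrite /= EFinM; apply: integrableZl => //.
  exact: integrable_J.
rewrite RintegralD// !RintegralZl//.
rewrite -!/(gauss_cas_int _) !gauss_cas_intE sqrrN /cas; ring.
Qed.

End gauss_cas.

(** * Integrals of products on tuples *)

Section tuple_integral.
Local Open Scope ereal_scope.
Context {dsp : measure_display} {T : measurableType dsp} {R : realType}.
Variable mu : {sigma_finite_measure set T -> \bar R}.

Lemma measurable_prod_tnth n (g : 'I_n -> T -> R) :
  (forall i, measurable_fun setT (g i)) ->
  measurable_fun setT (fun t : n.-tuple T => (\prod_(i < n) g i (tnth t i))%R).
Proof.
move=> mg; apply: measurable_prod => i _.
apply: measurableT_comp; [exact: mg|exact: measurable_tnth].
Qed.

Lemma ge0_integral_tuple_prod n (g : 'I_n -> T -> R) :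
  (forall i, measurable_fun setT (g i)) -> (forall i x, (0 <= g i x)%R) ->
  \int[tuple_measure mu n]_t (\prod_(i < n) g i (tnth t i))%:E =
  \prod_(i < n) \int[mu]_x (g i x)%:E.
Proof.
elim: n g => [|n IH] g mg g0.
  rewrite big_ord0 /= integral_dirac//; last first.
    by apply/measurable_EFinP; apply: measurable_prod_tnth.
  by rewrite diracE mem_set// mul1e big_ord0.
have mG : measurable_fun setT (fun t : n.+1.-tuple T =>
    (\prod_(i < n.+1) g i (tnth t i))%:E).
  by apply/measurable_EFinP; apply: measurable_prod_tnth.
have mG' : measurable_fun setT (fun t : n.-tuple T =>
    (\prod_(i < n) g (lift ord0 i) (tnth t i))%:E).
  apply/measurable_EFinP.
  exact: (@measurable_prod_tnth _ (fun i => g (lift ord0 i))).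
rewrite big_ord_recl -(IH (fun i => g (lift ord0 i)))//.
rewrite /= /cons_measure ge0_integral_pushforward//; last first.
  by move=> t _; rewrite lee_fin prodr_ge0.
rewrite preimage_setT fubini_tonelli1//=; last 2 first.
- exact: measurableT_comp.
- by move=> t; rewrite lee_fin prodr_ge0.
rewrite /fubini_F /=.
transitivity (\int[mu]_a ((g ord0 a)%:E *
    \int[tuple_measure mu n]_t (\prod_(i < n) g (lift ord0 i) (tnth t i))%:E)).
  apply: eq_integral => a _; rewrite -ge0_integralZl ?lee_fin//; last first.
    by move=> t _; rewrite lee_fin prodr_ge0.
  apply: eq_integral => t _; rewrite big_ord_recl /= EFinM.
  by under eq_bigr do rewrite tnthS.
rewrite ge0_integralZr//.
- exact/measurable_EFinP.
- by move=> x _; rewrite lee_fin.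
- by apply: integral_ge0 => t _; rewrite lee_fin prodr_ge0.
Qed.

Lemma integrable_tuple_prod n (g : 'I_n -> T -> R) :
  (forall i, mu.-integrable setT (EFin \o g i)) ->
  (tuple_measure mu n).-integrable setT
    (fun t => (\prod_(i < n) g i (tnth t i))%:E).
Proof.
move=> ig; have mg i : measurable_fun setT (g i).
  by have /integrableP[/measurable_EFinP] := ig i.
apply/integrableP; split.
  by apply/measurable_EFinP; apply: measurable_prod_tnth.
under eq_integral do rewrite /= normr_prod.
rewrite (@ge0_integral_tuple_prod _ (fun i x => `|g i x|%R))//; last first.
  by move=> i; apply: measurableT_comp.
rewrite (eq_bigr (fun i => (fine (\int[mu]_x `|g i x|%:E))%:E)).
  by rewrite prodEFin ltry.
move=> i _; rewrite fineK// ge0_fin_numE; last by apply: integral_ge0 => x _;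
  rewrite lee_fin.
by have /integrableP[] := ig i.
Qed.

Lemma Rintegral_tuple_prod n (g : 'I_n -> T -> R) :
  (forall i, mu.-integrable setT (EFin \o g i)) ->
  (\int[tuple_measure mu n]_t (\prod_(i < n) g i (tnth t i)) =
  \prod_(i < n) \int[mu]_x (g i x))%R.
Proof.
elim: n g => [|n IH] g ig.
  rewrite big_ord0 /Rintegral /= integral_dirac//; last first.
    apply/measurable_EFinP; apply: measurable_prod_tnth.
    by case.
  by rewrite diracE mem_set// mul1e big_ord0.
have mg i : measurable_fun setT (g i).
  by have /integrableP[/measurable_EFinP] := ig i.
have mG : measurable_fun setT (fun t : n.+1.-tuple T =>
    (\prod_(i < n.+1) g i (tnth t i))%:E).
  by apply/measurable_EFinP; apply: measurable_prod_tnth.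
have iG := integrable_tuple_prod ig.
have iG' := integrable_tuple_prod (fun i => ig (lift ord0 i)).
set h := (fun t : n.+1.-tuple T => _) in mG iG.
have ih : (mu \x tuple_measure mu n).-integrable setT (h \o Defs.cons_tuple).
  apply/integrableP; split; first exact: measurableT_comp.
  have /integrableP[_] := iG.
  rewrite /= /cons_measure ge0_integral_pushforward//.
  by apply/measurable_EFinP; apply: measurableT_comp => //;
    exact/measurable_EFinP.
rewrite big_ord_recl -(IH (fun i => g (lift ord0 i)))//.
rewrite {1}/Rintegral [X in fine X](_ : _ =
  \int[cons_measure mu (tuple_measure mu n)]_t h t)//.
rewrite integral_pushforward// preimage_setT -integral12_prod_meas1//=.
rewrite /fubini_F /= -RintegralZr//.
congr fine; apply: eq_integral => a _.
rewrite EFinM; rewrite [X in _ * X]fineK; last exact: integrable_fin_num.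
rewrite -integralZl//; apply: eq_integral => t _.
rewrite /h big_ord_recl /= EFinM.
by under eq_bigr do rewrite tnthS.
Qed.
End tuple_integral.

(** * Gaussian mixtures *)

Section kernel.
Context {R : realType} {d : nat}.
Notation mu := (@lebesgue_measure R).
Notation mud := (@lebesgue_Rd R d).
Implicit Types (x t : Rd R d) (P Q : probability (Rd R d) R).

Lemma gauss_density_sub x t :
  gauss_density (sub_Rd x t) = \prod_(i < d) gauss1 (tnth x i - tnth t i).
Proof.
rewrite /gauss_density /norm2 sqr_sqrtr; last by apply: sumr_ge0 => i _;
  exact: sqr_ge0.
under eq_bigr do rewrite /Rd_coord tnth_mktuple /Rd_coord.
rewrite /gauss1 big_split /= prodr_const card_ord -expR_sum; congr (_ * _).
  rewrite powRN [d%:R / 2]mulrC powRrM powR12_sqrt ?mulr_ge0 ?pi_ge0//.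
  by rewrite powR_mulrn ?sqrtr_ge0// exprVn.
by congr expR; rewrite mulr_suml -sumrN.
Qed.

Definition gauss0 x : R := \prod_(i < d) gauss1 (tnth x i).

Lemma gauss0_gt0 x : 0 < gauss0 x.
Proof. by apply: prodr_gt0 => i _; exact: gauss1_gt0. Qed.

Definition dot x t : R := \sum_(i < d) tnth x i * tnth t i.
Definition sqn t : R := \sum_(i < d) tnth t i ^+ 2.

Lemma gauss1D (a b : R) : gauss1 (a - b) = gauss1 a * expR (a * b - b ^+ 2 / 2).
Proof. by rewrite /gauss1 -[RHS]mulrA -expRD; congr (_ * expR _); field. Qed.

Lemma gauss_density_dot x t :
  gauss_density (sub_Rd x t) = gauss0 x * expR (dot x t - sqn t / 2).
Proof.
rewrite gauss_density_sub; under eq_bigr do rewrite gauss1D.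
rewrite big_split /= -expR_sum; congr (_ * expR _).
by rewrite sumrB mulr_suml.
Qed.

Lemma measurable_coord (i : 'I_d) : measurable_fun setT (fun x : Rd R d =>
  tnth x i).
Proof. exact: measurable_tnth. Qed.

Lemma measurable_gauss_kernel :
  measurable_fun setT (fun p : Rd R d * Rd R d =>
    gauss_density (sub_Rd p.1 p.2)).
Proof.
under eq_fun do rewrite gauss_density_sub.
apply: measurable_prod => i _; apply: measurableT_comp;
  first exact: measurable_gauss1.
apply: measurable_funB.
  by apply: (measurableT_comp (measurable_coord i)); exact: measurable_fst.
by apply: (measurableT_comp (measurable_coord i)); exact: measurable_snd.
Qed.

Lemma gauss_density_ge0 x : 0 <= @gauss_density R d x.
Proof. by rewrite mulr_ge0 ?powR_ge0 ?expR_ge0. Qed.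

Lemma measurable_gauss_kernel2 x :
  measurable_fun setT (fun t => gauss_density (sub_Rd x t)).
Proof.
under eq_fun do rewrite gauss_density_sub.
apply: (@measurable_prod_tnth _ (measurableTypeR R) R d (fun i y =>
  gauss1 (tnth x i - y))) => i.
by apply: measurableT_comp; [exact: measurable_gauss1|exact: measurable_funB].
Qed.

Lemma measurable_gauss_kernel1 t :
  measurable_fun setT (fun x => gauss_density (sub_Rd x t)).
Proof.
under eq_fun do rewrite gauss_density_sub.
apply: (@measurable_prod_tnth _ (measurableTypeR R) R d (fun i y =>
  gauss1 (y - tnth t i))) => i.
by apply: measurableT_comp; [exact: measurable_gauss1|exact: measurable_funB].
Qed.

Lemma gauss_density_le x t : gauss_density (sub_Rd x t) <=
  ((Num.sqrt (2 * pi))^-1) ^+ d.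
Proof.
rewrite gauss_density_sub -[X in _ ^+ X](card_ord d) -prodr_const.
apply: ler_prod => i _; rewrite gauss1_ge0 /gauss1 ler_piMr ?invr_ge0
  ?sqrtr_ge0//.
by rewrite -[leRHS]expR0 ler_expR oppr_le0 divr_ge0 ?sqr_ge0.
Qed.

(** The real-valued integral in [gauss_mixture] would turn an infinite value into 0. The kernel is
    bounded, so this does not occur and Tonelli can be used on the extended integral. *)
Lemma EFin_gauss_mixture P x :
  ((gauss_mixture P x)%:E = \int[P]_t (gauss_density (sub_Rd x t))%:E)%E.
Proof.
rewrite /gauss_mixture /Rintegral fineK//; apply: integrable_fin_num => //.
apply: measurable_bounded_integrable => //.
- by apply: le_lt_trans (probability_le1 P measurableT) _; rewrite ltry.
- exact: measurable_gauss_kernel2.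
- exists (((Num.sqrt (2 * pi))^-1) ^+ d); split; first exact: num_real.
  move=> b bM t _ /=; rewrite ger0_norm ?gauss_density_ge0//.
  by apply: le_trans (ltW bM); exact: gauss_density_le.
Qed.

Lemma gauss_mixture_ge0 P x : 0 <= gauss_mixture P x.
Proof. by apply: Rintegral_ge0 => t _; exact: gauss_density_ge0. Qed.

Lemma measurable_gauss_mixture P : measurable_fun setT (gauss_mixture P).
Proof.
apply/measurable_EFinP.
rewrite (_ : EFin \o _ =
  fubini_F P (fun p => (gauss_density (sub_Rd p.1 p.2))%:E)).
  apply: measurable_fun_fubini_tonelli_F => [|p].
    by apply/measurable_EFinP; exact: measurable_gauss_kernel.
  by rewrite lee_fin gauss_density_ge0.
by apply/funext => x; rewrite /= EFin_gauss_mixture.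
Qed.

Lemma integral_gauss_kernel t : (\int[mud]_x (gauss_density (sub_Rd x t))%:E =
  1)%E.
Proof.
under eq_integral do rewrite gauss_density_sub.
rewrite (ge0_integral_tuple_prod lebesgue_measure
  (g := fun i y => gauss1 (y - tnth t i))).
- by rewrite big1// => i _; exact: integral_gauss1.
- move=> i; apply: measurableT_comp; first exact: measurable_gauss1.
  exact: measurable_funB.
- by move=> i y; exact: gauss1_ge0.
Qed.

Lemma integral_gauss_mixture P : (\int[mud]_x (gauss_mixture P x)%:E = 1)%E.
Proof.
under eq_integral do rewrite EFin_gauss_mixture.
rewrite (fubini_tonelli (fun p => (gauss_density (sub_Rd p.1 p.2))%:E)) /=.
- under eq_integral do rewrite integral_gauss_kernel.
  by rewrite integral_cst// mul1e; exact: probability_setT.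
- by apply/measurable_EFinP; exact: measurable_gauss_kernel.
- by move=> p; rewrite lee_fin gauss_density_ge0.
Qed.

Lemma integrable_gauss_mixture P : mud.-integrable setT
  (EFin \o gauss_mixture P).
Proof.
apply/integrableP; split; first by apply/measurable_EFinP;
  exact: measurable_gauss_mixture.
under eq_integral do rewrite /= ger0_norm ?gauss_mixture_ge0//.
by rewrite integral_gauss_mixture ltry.
Qed.

(** A product over coordinates, not [cas] of a scalar product: Gaussian integrals and Taylor
    expansions both factor. *)
Definition casd (xi : 'I_d -> R) x : R := \prod_(i < d) cas (xi i * tnth x i).

Lemma measurable_casd xi : measurable_fun setT (casd xi).
Proof.
apply: measurable_prod => i _; apply: measurableT_comp.
  by apply: continuous_measurable_fun; exact: continuous_cas.
by apply: measurable_funM => //; exact: measurable_coord.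
Qed.

Lemma norm_casd_le xi x : `|casd xi x| <= 2 ^+ d.
Proof.
rewrite normr_prod -[X in _ ^+ X](card_ord d) -prodr_const.
by apply: ler_prod => i _; rewrite normr_ge0 norm_cas_le.
Qed.

Lemma integral_casd_kernel xi t :
  \int[mud]_x (casd xi x * gauss_density (sub_Rd x t)) =
  expR (- ((\sum_i xi i ^+ 2) / 2)) * casd xi t.
Proof.
transitivity (\int[mud]_x \prod_(i < d) (gauss1 (tnth x i - tnth t i) * cas
  (xi i * tnth x i))).
  by apply: eq_Rintegral => x _; rewrite gauss_density_sub /casd [LHS]mulrC
    -big_split.
rewrite (Rintegral_tuple_prod (mu := lebesgue_measure)
  (g := fun i y => gauss1 (y - tnth t i) * cas (xi i * y))); last first.
  move=> i; have := integrable_gauss1_cas (tnth t i) (xi i) 0.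
  by under eq_fun do rewrite addr0.
under eq_bigr do rewrite integral_gauss1_cas.
by rewrite big_split /= -expR_sum mulr_suml sumrN.
Qed.

Lemma measurable_casd_kernel xi : measurable_fun setT
  (fun p : Rd R d * Rd R d => casd xi p.1 * gauss_density (sub_Rd p.1 p.2)).
Proof.
apply: measurable_funM; last exact: measurable_gauss_kernel.
by apply: measurableT_comp; [exact: measurable_casd|exact: measurable_fst].
Qed.

Lemma integrable_prob_bounded P (f : Rd R d -> R) (c : R) : measurable_fun setT
  f ->
  (forall t, `|f t| <= c) -> P.-integrable setT (EFin \o f).
Proof.
move=> mf fc; apply: measurable_bounded_integrable => //.
- by apply: le_lt_trans (probability_le1 P measurableT) _; rewrite ltry.
- exists c; split; first exact: num_real.
  by move=> b cb t _ /=; apply: le_trans (ltW cb).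
Qed.

Lemma integrable_kernel1 t :
  mud.-integrable setT (fun x => (gauss_density (sub_Rd x t))%:E).
Proof.
apply/integrableP; split; first by apply/measurable_EFinP;
  exact: measurable_gauss_kernel1.
under eq_integral do rewrite /= ger0_norm ?gauss_density_ge0//.
by rewrite integral_gauss_kernel ltry.
Qed.

Lemma integrable_casdM xi (f : Rd R d -> R) :
  mud.-integrable setT (EFin \o f) ->
    mud.-integrable setT (EFin \o (fun x => casd xi x * f x)).
Proof.
move=> fi; have mf : measurable_fun setT f
  by have /integrableP[/measurable_EFinP] := fi.
apply: (@le_integrable _ _ _ mud setT measurableT _ (fun x =>
  ((2 ^+ d)%:E * (f x)%:E)%E)).
- apply/measurable_EFinP; apply: measurable_funM => //; exact: measurable_casd.
- move=> x _; rewrite -EFinM /= lee_fin !normrM (ger0_norm (exprn_ge0 _ _))//.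
  by rewrite ler_wpM2r// norm_casd_le.
- exact: integrableZl.
Qed.

Lemma integral_casd_mixture P xi :
  \int[mud]_x (casd xi x * gauss_mixture P x) =
  expR (- ((\sum_i xi i ^+ 2) / 2)) * \int[P]_t casd xi t.
Proof.
pose F := fun p : Rd R d * Rd R d =>
  (casd xi p.1 * gauss_density (sub_Rd p.1 p.2))%:E.
have mF : measurable_fun setT F by apply/measurable_EFinP;
  exact: measurable_casd_kernel.
have iF : (mud \x P)%E.-integrable setT F.
  apply/integrable21ltyP => //.
  apply: (@le_lt_trans _ _ (\int[P]_t (2 ^+ d)%:E)%E).
    apply: ge0_le_integral => //.
    - by move=> t _; exact: integral_ge0.
    - apply: (measurable_fun_fubini_tonelli_G (fun p => `|F p|%E)) => //.
      exact: measurableT_comp.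
    - move=> t _.
      apply: (@le_trans _ _
        (\int[mud]_x ((2 ^+ d)%:E * (gauss_density (sub_Rd x t))%:E))%E).
        apply: ge0_le_integral => //.
        - apply: measurableT_comp => //; apply/measurable_EFinP.
          by apply: measurable_funM;
            [exact: measurable_casd|exact: measurable_gauss_kernel1].
        - by apply/measurable_EFinP; apply: measurable_funM => //;
          exact: measurable_gauss_kernel1.
        - move=> x _; rewrite /F /= lee_fin normrM
          (ger0_norm (gauss_density_ge0 _)).
          by rewrite ler_wpM2r ?gauss_density_ge0// norm_casd_le.
      rewrite ge0_integralZl ?lee_fin ?exprn_ge0//.
      - by rewrite integral_gauss_kernel mule1.
      - by apply/measurable_EFinP; exact: measurable_gauss_kernel1.
      - by move=> x _; rewrite lee_fin gauss_density_ge0.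
  rewrite integral_cst//; apply: (@le_lt_trans _ _ ((2 ^+ d)%:E * 1)%E); last
    by rewrite mule1 ltry.
  by rewrite lee_wpmul2l ?lee_fin ?exprn_ge0// probability_le1.
transitivity (fine (\int[mud]_x \int[P]_t F (x, t))).
  congr fine; apply: eq_integral => x _;
    rewrite EFinM EFin_gauss_mixture -integralZl//.
  apply: (@integrable_prob_bounded _ _ ((Num.sqrt (2 * pi))^-1 ^+ d)).
    exact: measurable_gauss_kernel2.
  by move=> t; rewrite ger0_norm ?gauss_density_ge0// gauss_density_le.
rewrite Fubini// -RintegralZl//; last first.
  by apply: (@integrable_prob_bounded _ _ (2 ^+ d));
    [exact: measurable_casd|exact: norm_casd_le].
congr fine; apply: eq_integral => t _; rewrite -integral_casd_kernel.
rewrite fineK//; apply: integrable_fin_num => //.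
by apply: (@integrable_casdM xi (fun x => gauss_density (sub_Rd x t)));
  exact: integrable_kernel1.
Qed.

(** Tests f - g, of L^1 norm 2 TV, against a function bounded by 2^d. The exponential undoes the
    multiplier of [integral_casd_mixture]. *)
Lemma casd_le_TV P Q xi :
  `|\int[P]_t casd xi t - \int[Q]_t casd xi t| <=
  expR ((\sum_i xi i ^+ 2) / 2)
    * (2 ^+ d * (2 * TV (gauss_mixture P) (gauss_mixture Q))).
Proof.
set f := gauss_mixture P; set g := gauss_mixture Q.
have [fi gi] := (integrable_gauss_mixture P, integrable_gauss_mixture Q).
have fgi : mud.-integrable setT (EFin \o (fun x => f x - g x)).
  by rewrite [X in _ _ _ X](_ : _ = (fun x => (f x)%:E - (g x)%:E)%E)//;
    exact: integrableB.
have e0 : 0 < expR ((\sum_i xi i ^+ 2) / 2) by exact: expR_gt0.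
rewrite -[leLHS](mulVKf (lt0r_neq0 e0)) -expRN ler_wpM2l ?(ltW e0)//.
rewrite -[X in X * `|_|]ger0_norm ?expR_ge0// -normrM mulrBr
  -!integral_casd_mixture.
rewrite -RintegralB//; try exact: integrable_casdM.
under eq_Rintegral do rewrite -mulrBr.
apply: le_trans (le_normr_Rintegral _ _) _ => //; first exact: integrable_casdM.
rewrite /TV (mulrA 2 2^-1) divff ?pnatr_eq0// mul1r.
have nfgi : mud.-integrable setT (EFin \o (fun x => `|f x - g x|)).
  exact: (integrable_norm fgi).
rewrite -RintegralZl//; apply: le_Rintegral => //.
- by have := integrable_norm (integrable_casdM xi fgi).
- rewrite [X in _ _ _ X](_ : _ =
  (fun x => (2 ^+ d)%:E * (`|f x - g x|)%:E)%E)//.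
  exact: integrableZl.
- by move=> x _; rewrite normrM ler_wpM2r// norm_casd_le.
Qed.

End kernel.

(** * Inner products of mixtures in L^2(dx / gauss0) *)

Section mixture_product.
Context {R : realType} {d : nat}.
Notation mu := (@lebesgue_measure R).
Notation mud := (@lebesgue_Rd R d).
Implicit Types (x t : Rd R d) (P Q : probability (Rd R d) R).
Notation ker x t := (gauss_density (sub_Rd x t)).

Lemma measurable_funV (f : Rd R d -> R) : measurable_fun setT f ->
  (forall x, 0 <= f x) ->
  measurable_fun setT (fun x => (f x)^-1).
Proof.
move=> mf f0; under eq_fun do rewrite -powR_inv1//.
by apply: (measurableT_comp (measurable_powR _)).
Qed.

Lemma measurable_gauss0 : measurable_fun setT (@gauss0 R d).
Proof.
apply: (@measurable_prod_tnth _ (measurableTypeR R) R d (fun i y => gauss1 y))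
  => i.
exact: measurable_gauss1.
Qed.

Lemma measurable_dot : measurable_fun setT (fun p : Rd R d * Rd R d =>
  dot p.1 p.2).
Proof.
apply: measurable_sum => i; apply: measurable_funM.
  by apply: (measurableT_comp (measurable_coord i)); exact: measurable_fst.
by apply: (measurableT_comp (measurable_coord i)); exact: measurable_snd.
Qed.

Lemma measurable_dot2 x : measurable_fun setT (dot x).
Proof.
by apply: measurable_sum => i; apply: measurable_funM => //;
  exact: measurable_coord.
Qed.

(** Completing the square: the integrand is the Gaussian density centred at s + t times e^<s, t>. *)
Lemma integral_kernel_prod (s t : Rd R d) :
  (\int[mud]_x (ker x s * ker x t / gauss0 x)%:E = (expR (dot s t))%:E)%E.
Proof.
have i1 (a b : R) : (\int[mu]_y (gauss1 (y - a) * expR b)%:E = (expR b)%:E)%E.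
  under eq_integral do rewrite EFinM.
  rewrite ge0_integralZr ?lee_fin ?expR_ge0//.
  - by rewrite integral_gauss1 mul1e.
  - apply/measurable_EFinP; apply: measurableT_comp;
    first exact: measurable_gauss1.
    exact: measurable_funB.
  - by move=> y _; rewrite lee_fin gauss1_ge0.
have e x : ker x s * ker x t / gauss0 x =
    \prod_(i < d) (gauss1 (tnth x i - (tnth s i + tnth t i)) * expR
      (tnth s i * tnth t i)).
  rewrite !gauss_density_sub /gauss0 -prodfV -!big_split /=; apply: eq_bigr =>
    i _.
  rewrite !gauss1D.
  have g0 : gauss1 (tnth x i) != 0 by rewrite gt_eqF ?gauss1_gt0.
  transitivity (gauss1 (tnth x i)
    * (expR (tnth x i * tnth s i - tnth s i ^+ 2 / 2) *
    expR (tnth x i * tnth t i - tnth t i ^+ 2 / 2))); first by field.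
  by rewrite -[RHS]mulrA -!expRD; congr (_ * expR _); field.
under eq_integral do rewrite e.
rewrite (ge0_integral_tuple_prod lebesgue_measure
  (g := fun i y => gauss1 (y - (tnth s i + tnth t i)) * expR
    (tnth s i * tnth t i))).
- under eq_bigr do rewrite i1.
  by rewrite prodEFin -expR_sum.
- move=> i; apply: measurable_funM => //; apply: measurableT_comp;
  first exact: measurable_gauss1.
  exact: measurable_funB.
- by move=> i y; rewrite mulr_ge0 ?gauss1_ge0 ?expR_ge0.
Qed.

Lemma integral_mixture_prod P Q :
  (\int[mud]_x (gauss_mixture P x * gauss_mixture Q x / gauss0 x)%:E =
   \int[P]_s \int[Q]_t (expR (dot s t))%:E)%E.
Proof.
have mV : measurable_fun setT (fun x => (@gauss0 R d x)^-1).
  by apply: measurable_funV => [|x];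
    [exact: measurable_gauss0|rewrite ltW ?gauss0_gt0].
have V0 x : 0 <= (@gauss0 R d x)^-1 by rewrite invr_ge0 ltW ?gauss0_gt0.
pose F p := (ker p.1 p.2 * (gauss_mixture Q p.1 / gauss0 p.1))%:E.
transitivity (\int[mud]_x \int[P]_s F (x, s))%E.
  apply: eq_integral => x _; rewrite -mulrA EFinM EFin_gauss_mixture
    -ge0_integralZr//.
  - by apply/measurable_EFinP; exact: measurable_gauss_kernel2.
  - by move=> t _; rewrite lee_fin gauss_density_ge0.
  - by rewrite lee_fin mulr_ge0 ?gauss_mixture_ge0.
rewrite (fubini_tonelli F); last 2 first.
- apply/measurable_EFinP; apply: measurable_funM;
  first exact: measurable_gauss_kernel.
  apply: (@measurableT_comp _ _ _ _ _ _ (fun x => gauss_mixture Q x / gauss0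
    x)).
    by apply: measurable_funM => //; exact: measurable_gauss_mixture.
  exact: measurable_fst.
- move=> p; rewrite /F lee_fin mulr_ge0 ?gauss_density_ge0//.
  by rewrite mulr_ge0 ?gauss_mixture_ge0.
apply: eq_integral => s _.
pose G p := (ker p.1 s * ker p.1 p.2 / gauss0 p.1)%:E.
transitivity (\int[mud]_x \int[Q]_t G (x, t))%E.
  apply: eq_integral => x _.
  rewrite [RHS](eq_integral (fun t =>
    (ker x s / gauss0 x)%:E * (ker x t)%:E)%E); last first.
    by move=> t _; rewrite /G -EFinM mulrAC.
  rewrite ge0_integralZl; [|by []|..].
  - by rewrite -EFin_gauss_mixture -EFinM /F /= mulrA mulrAC.
  - by apply/measurable_EFinP; exact: measurable_gauss_kernel2.
  - by move=> t _; rewrite lee_fin gauss_density_ge0.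
  - rewrite lee_fin; apply: mulr_ge0 => //; exact: gauss_density_ge0.
rewrite (fubini_tonelli G).
- by apply: eq_integral => t _; exact: integral_kernel_prod.
- apply/measurable_EFinP; apply: measurable_funM; last first.
    by apply: (@measurableT_comp _ _ _ _ _ _ (fun x => (gauss0 x)^-1)).
  apply: measurable_funM; last exact: measurable_gauss_kernel.
  apply: (@measurableT_comp _ _ _ _ _ _ (fun x => ker x s));
    last exact: measurable_fst.
  exact: measurable_gauss_kernel1.
- by move=> p; rewrite /G lee_fin mulr_ge0// mulr_ge0 ?gauss_density_ge0.
Qed.
End mixture_product.

(** * Integration against a probability carried by a measurable set *)

Section full_measure.
Context {dsp : measure_display} {T : measurableType dsp} {R : realType}.
Variables (P : probability T R) (D : set T).
Hypotheses (mD : measurable D) (PD : P D = 1%E).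

Lemma prob_compl0 : P (~` D) = 0%E.
Proof. by rewrite probability_setC// PD subee. Qed.

Lemma integrable_prob (u : T -> R) (c : R) : measurable_fun setT u ->
  (forall t, D t -> `|u t| <= c) -> P.-integrable setT (EFin \o u).
Proof.
move=> mu uc; apply/integrableP; split; first exact/measurable_EFinP.
have mau : measurable_fun setT (fun t => `|(EFin \o u) t|%E).
  by apply: measurableT_comp => //; exact/measurable_EFinP.
rewrite (ge0_negligible_integral _ _ _ _ prob_compl0)//;
  last exact: measurableC.
rewrite setTD setCK.
apply: (@le_lt_trans _ _ (\int[P]_(t in D) c%:E)%E).
  by apply: ge0_le_integral => //; exact: measurable_funS mau.
by rewrite (integral_cst P mD) [X in (_ * X)%E]PD mule1 ltry.
Qed.

Lemma Rintegral_prob_le (u : T -> R) (c : R) : P.-integrable setT (EFin \o u) ->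
  (forall t, D t -> u t <= c) -> \int[P]_t u t <= c.
Proof.
move=> iu uc.
have -> : (\int[P]_t u t) = \int[P]_(t in D) u t.
  rewrite /Rintegral (negligible_integral _ _ iu prob_compl0)//;
    last exact: measurableC.
  by rewrite setTD setCK.
have iuD : P.-integrable D (EFin \o u) by apply: integrableS iu.
apply: (@le_trans _ _ (\int[P]_(t in D) c)); last
  by rewrite Rintegral_cst// [X in fine X]PD mulr1.
by apply: le_Rintegral => //; exact: finite_measure_integrable_cst.
Qed.

Lemma Rintegral_prob_ge (u : T -> R) (c : R) : P.-integrable setT (EFin \o u) ->
  (forall t, D t -> c <= u t) -> c <= \int[P]_t u t.
Proof.
move=> iu uc; rewrite -lerN2.
have -> : - (\int[P]_t u t) = \int[P]_t (-1 * u t)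
  by rewrite RintegralZl// mulN1r.
apply: Rintegral_prob_le => [|t Dt]; last by rewrite mulN1r lerN2 uc.
rewrite [X in _ _ _ X](_ : _ = (fun x => (-1)%:E * (u x)%:E)%E)//.
exact: integrableZl.
Qed.

Lemma Rintegral_prob_dist (u v : T -> R) (c : R) :
  P.-integrable setT (EFin \o u) -> P.-integrable setT (EFin \o v) ->
  (forall t, D t -> `|u t - v t| <= c) -> `|(\int[P]_t u t) - (\int[P]_t v t)|
    <= c.
Proof.
move=> iu iv uvc; rewrite -RintegralB//.
have iuv : P.-integrable setT (EFin \o (fun t => u t - v t)).
  by rewrite [X in _ _ _ X](_ : _ = (fun x => (u x)%:E - (v x)%:E)%E)//;
    exact: integrableB.
rewrite ler_norml; apply/andP; split.
  apply: Rintegral_prob_ge => // t Dt.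
  by have := uvc t Dt; rewrite ler_norml => /andP[].
apply: Rintegral_prob_le => // t Dt.
by have := uvc t Dt; rewrite ler_norml => /andP[].
Qed.

Lemma integrable_lin (I : finType) (S : pred I) (c : I -> R) (u : I -> T -> R) :
  (forall i, P.-integrable setT (EFin \o u i)) ->
  P.-integrable setT (EFin \o (fun t => \sum_(i | S i) c i * u i t)).
Proof.
move=> iu.
rewrite [X in _ _ _ X](_ : _ =
  (fun t => \sum_(i | S i) (c i)%:E * (u i t)%:E)%E).
  by apply: integrable_sum => // i Si;
    exact: (integrableZl measurableT _ (iu i)).
by apply/funext => t; rewrite /= -sumEFin; apply: eq_bigr.
Qed.

Lemma Rintegral_lin (I : finType) (S : pred I) (c : I -> R) (u : I -> T -> R) :
  (forall i, P.-integrable setT (EFin \o u i)) ->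
  (\int[P]_t (\sum_(i | S i) c i * u i t)) = \sum_(i | S i) c
    i * (\int[P]_t u i t).
Proof.
move=> iu; rewrite /Rintegral.
rewrite (eq_integral (fun t => \sum_(i | S i) (c i)%:E * (u i t)%:E)%E);
  last first.
  by move=> t _; rewrite -sumEFin; apply: eq_bigr.
rewrite integral_sum//; last by move=> i;
  exact: (integrableZl measurableT _ (iu i)).
rewrite (eq_bigr (fun i => (c i * fine (\int[P]_t (u i t)%:E))%:E)) ?sumEFin//.
move=> i _; rewrite EFinM fineK; last exact: integrable_fin_num (iu i).
by rewrite -integralZl//; exact: iu.
Qed.

End full_measure.

(** * Moments *)

Section moments.
Context {R : realType} {d : nat}.
Implicit Types (x s t : Rd R d) (P Q : probability (Rd R d) R).
Variables (M : R) (hM : 0 < M).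
Notation D := (@cube R d M).

Lemma measurable_cube : measurable D.
Proof.
rewrite /cube (_ : mkset _ = \bigcap_(i in [set: 'I_d])
    ((fun x : Rd R d => tnth x i) @^-1` `[- M, M]%classic)).
  apply: fin_bigcap_measurable => // i _.
  by rewrite -[X in measurable X]setTI; apply: measurable_coord.
by apply/seteqP; split => [x xM i _|x xM i]; [exact: xM|exact: (xM i)].
Qed.

Lemma cube_norm t i : D t -> `|tnth t i| <= M.
Proof. by move=> /(_ i); rewrite /Rd_coord in_itv /= ler_norml. Qed.

Definition norm1 x : R := \sum_(i < d) `|tnth x i|.

Lemma norm1_ge0 x : 0 <= norm1 x.
Proof. by apply: sumr_ge0. Qed.

Lemma norm1_cube t : D t -> norm1 t <= d%:R * M.
Proof.
move=> Dt; apply: (@le_trans _ _ (\sum_(i < d) M)).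
  by apply: ler_sum => i _; exact: cube_norm.
by rewrite sumr_const card_ord mulr_natl.
Qed.

Lemma dot_cube x t : D t -> `|dot x t| <= M * norm1 x.
Proof.
move=> Dt; apply: le_trans (ler_norm_sum _ _ _) _.
rewrite mulr_sumr; apply: ler_sum => i _.
by rewrite normrM mulrC ler_wpM2r// cube_norm.
Qed.

Definition expdot Q s : R := \int[Q]_t expR (dot s t).

(** By [integral_mixture_prod], the inner product of the two mixtures in L^2(dx / gauss0). [expdot]
    is the moment generating function. *)
Definition gram P Q : R := \int[P]_s expdot Q s.

Lemma measurable_expR_dot s : measurable_fun setT (fun t => expR (dot s t)).
Proof. by apply: measurableT_comp => //; exact: measurable_dot2. Qed.

Section one_measure.
Variables (Q : probability (Rd R d) R) (QD : Q D = 1%E).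

Lemma integrable_expR_dot s : Q.-integrable setT (fun t => (expR (dot s t))%:E).
Proof.
apply: (integrable_prob measurable_cube QD (c := expR (M * norm1 s))).
  exact: measurable_expR_dot.
move=> t Dt; rewrite ger0_norm ?expR_ge0// ler_expR.
by apply: le_trans (dot_cube _ Dt); exact: ler_norm.
Qed.

Lemma EFin_expdot s : (\int[Q]_t (expR (dot s t))%:E = (expdot Q s)%:E)%E.
Proof.
rewrite /expdot /Rintegral fineK//; apply: integrable_fin_num => //.
exact: integrable_expR_dot.
Qed.

Lemma measurable_expdot : measurable_fun setT (expdot Q).
Proof.
apply/measurable_EFinP.
rewrite (_ : EFin \o _ = fubini_F Q (fun p => (expR (dot p.1 p.2))%:E)).
  apply: measurable_fun_fubini_tonelli_F => [|p]; last
    by rewrite lee_fin expR_ge0.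
  by apply/measurable_EFinP; apply: measurableT_comp => //;
    exact: measurable_dot.
by apply/funext => x; rewrite /= -EFin_expdot.
Qed.

Definition monom n (k : {ffun 'I_d -> 'I_n}) t : R := \prod_i tnth t i ^+ k i.

Definition moment n (k : {ffun 'I_d -> 'I_n}) : R := \int[Q]_t monom k t.

Lemma measurable_monom n (k : {ffun 'I_d -> 'I_n}) : measurable_fun setT
  (monom k).
Proof.
apply: measurable_prod => i _.
by apply: (measurable_funX (f := fun t : Rd R d => tnth t i));
  exact: measurable_coord.
Qed.

Lemma integrable_monom n (k : {ffun 'I_d -> 'I_n}) : Q.-integrable setT
  (EFin \o monom k).
Proof.
apply: (integrable_prob measurable_cube QD (c := \prod_i M ^+ k i)).
  exact: measurable_monom.
move=> t Dt; rewrite normr_prod; apply: ler_prod => i _;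
  rewrite normr_ge0 normrX /=.
by rewrite lerXn2r ?nnegrE ?(ltW hM)// cube_norm.
Qed.

Lemma integrable_casd xi : Q.-integrable setT (EFin \o casd xi).
Proof.
by apply: (@integrable_prob_bounded _ _ _ _ (2 ^+ d));
  [exact: measurable_casd|exact: norm_casd_le].
Qed.

Variable N : nat.
Notation mi := {ffun 'I_d -> 'I_N.+2}.
Notation low := (fun k : mi => (\sum_i k i <= N)%N).

(** [prod_taylor] for the product of the e^(s_i t_i), integrated in t. The index type 'I_N.+2 is
    inherited from there; [low] never reaches the remainder value N.+1. *)
Lemma expdot_taylor s (rho : R) : 1 <= rho -> D s ->
  `|expdot Q s - \sum_(k : mi | low k) (\prod_i (k i)`!%:R^-1 * moment k)
    * monom k s|
  <= rho ^- N.+1 * expR (rho * (d%:R * M ^+ 2)).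
Proof.
move=> rho1 Ds.
rewrite [X in `|_ - X|](_ : _ = \int[Q]_t \sum_(k : mi | low k)
    (\prod_i (k i)`!%:R^-1 * monom k s) * monom k t); last first.
  rewrite (Rintegral_lin _ _ (fun k : mi => integrable_monom k)).
  by apply: eq_bigr => k _; rewrite mulrAC.
apply: (Rintegral_prob_dist measurable_cube QD).
- exact: integrable_expR_dot.
- exact: (integrable_lin _ _ (fun k : mi => integrable_monom k)).
move=> t Dt.
have := @prod_taylor R d N (fun=> 1) (fun i => expR (tnth s i * tnth t i))
  (fun i => tnth s i * tnth t i) rho _ rho1 (fun i => @cvg_exp R _).
rewrite -expR_sum normr1 => /(_ (fun=> lexx _)) h.
apply: le_trans (_ : _ <= rho ^- N.+1 * expR
  (rho * \sum_i `|tnth s i * tnth t i|)) _.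
  rewrite [X in `|_ - X|](_ : _ = \sum_(k : mi | low k)
    \prod_i (1 * ((tnth s i * tnth t i) ^+ k i / (k i)`!%:R)))//.
  apply: eq_bigr => k _; rewrite /monom -!big_split /=; apply: eq_bigr => i _.
  by rewrite mul1r exprMn; ring.
rewrite ler_wpM2l ?invr_ge0 ?exprn_ge0 ?(le_trans _ rho1)// ler_expR.
rewrite ler_wpM2l ?(le_trans _ rho1)//.
apply: (@le_trans _ _ (\sum_(i < d) M ^+ 2)); last
  by rewrite sumr_const card_ord mulr_natl.
by apply: ler_sum => i _; rewrite normrM expr2 ler_pM ?cube_norm.
Qed.

End one_measure.

Section two_measures.
Variables (P Q : probability (Rd R d) R) (PD : P D = 1%E) (QD : Q D = 1%E).

Lemma integrable_expdot : P.-integrable setT (EFin \o expdot Q).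
Proof.
apply: (integrable_prob measurable_cube PD (c := expR (M * (d%:R * M)))).
  exact: (measurable_expdot QD).
move=> s Ds; rewrite ger0_norm; last by apply: Rintegral_ge0 => t _;
  exact: expR_ge0.
apply: (Rintegral_prob_le measurable_cube QD (integrable_expR_dot QD s)) =>
  t Dt.
rewrite ler_expR (le_trans (ler_norm _))// (le_trans (dot_cube _ Dt))//.
by rewrite ler_wpM2l ?(ltW hM)// norm1_cube.
Qed.

Lemma EFin_gram : (\int[P]_s \int[Q]_t (expR (dot s t))%:E = (gram P Q)%:E)%E.
Proof.
under eq_integral do rewrite (EFin_expdot QD).
rewrite /gram /Rintegral fineK//; apply: integrable_fin_num => //.
exact: integrable_expdot.
Qed.

Lemma gram_taylor N (rho : R) : 1 <= rho ->
  `|gram P Q - \sum_(k : {ffun 'I_d -> 'I_N.+2} | (\sum_i k i <= N)%N)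
     \prod_i (k i)`!%:R^-1 * moment P k * moment Q k|
  <= rho ^- N.+1 * expR (rho * (d%:R * M ^+ 2)).
Proof.
move=> rho1.
rewrite [X in `|_ - X|](_ : _ =
  \int[P]_s \sum_(k : {ffun 'I_d -> 'I_N.+2} | (\sum_i k i <= N)%N)
     (\prod_i (k i)`!%:R^-1 * moment Q k) * monom k s); last first.
  rewrite (Rintegral_lin _ _ (fun k : {ffun 'I_d -> 'I_N.+2} =>
    integrable_monom PD k)).
  by apply: eq_bigr => k _; rewrite mulrAC.
apply: (Rintegral_prob_dist measurable_cube PD).
- exact: integrable_expdot.
- exact: (integrable_lin _ _ (fun k : {ffun 'I_d -> 'I_N.+2} =>
  integrable_monom PD k)).
by move=> s Ds; exact: expdot_taylor.
Qed.

End two_measures.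

Section moment_bound.
Variables (N : nat) (k : {ffun 'I_d -> 'I_N.+2}) (kN : (\sum_i k i <= N)%N).
Variables (r : 'I_d -> R) (r0 : forall i, 0 <= r i) (rho : R) (rho1 : 1 <= rho).
Let B : R := N.+1%:R ^+ d * 2 ^+ d * (5 / 2) ^+ N.
Let err : R := rho ^- N.+1 * expR (rho * (M * \sum_i r i)).
Let xi (a : {ffun 'I_d -> 'I_(2 * N).+1}) (i : 'I_d) : R :=
  r i * cheb_node (a i).
Let kn (i : 'I_d) : nat := k i.

(** As a function of the nodes, [casd (xi a) t] is within [err] of a polynomial of total degree at
    most N. [tensor_weight] extracts the coefficient of index k exactly, and the remainder is
    amplified by at most [B]. *)
Lemma casd_weight_taylor t : D t ->
  `|\sum_a tensor_weight kn a * casd (xi a) t -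
    \prod_i (cas_coeff (k i) * (r i ^+ k i / (k i)`!%:R)) * monom k t| <=
      B * err.
Proof.
move=> Dt.
pose u a i := xi a i * tnth t i.
pose low := (fun l : {ffun 'I_d -> 'I_N.+2} => (\sum_i l i <= N)%N).
pose pol a := \sum_(l | low l) \prod_i
  (cas_coeff (l i) * (u a i ^+ l i / (l i)`!%:R)).
have hpol a : `|casd (xi a) t - pol a| <= err.
  apply: le_trans (@prod_taylor R d N (@cas_coeff R) (fun i => cas (u a i))
    (u a) rho _ rho1 (fun i => @cvg_cas R _)) _.
    by move=> l; rewrite norm_cas_coeff.
  rewrite /err ler_wpM2l ?invr_ge0 ?exprn_ge0 ?(le_trans _ rho1)// ler_expR.
  rewrite ler_wpM2l ?(le_trans _ rho1)// mulr_sumr; apply: ler_sum => i _.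
  rewrite /u /xi !normrM (ger0_norm (r0 i)) mulrC ler_pM ?mulr_ge0 ?cube_norm//.
  by rewrite ler_piMr ?r0// cheb_node_le1.
have polE : \sum_a tensor_weight kn a * pol a =
    \prod_i (cas_coeff (k i) * (r i ^+ k i / (k i)`!%:R)) * monom k t.
  under [LHS]eq_bigr do rewrite /pol mulr_sumr.
  rewrite exchange_big /= (bigD1 k)//=.
  have inner (l : {ffun 'I_d -> 'I_N.+2}) : low l -> \sum_a tensor_weight kn a *
      \prod_i (cas_coeff (l i) * (u a i ^+ l i / (l i)`!%:R)) =
      \prod_i (kn i == l i)%:R *
      (\prod_i (cas_coeff (l i) * (r i ^+ l i / (l i)`!%:R)) * monom l t).
    move=> lN; rewrite -(tensor_weight_dual kn lN) mulr_suml; apply: eq_bigr =>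
      a _.
    rewrite -mulrA; congr (_ * _); rewrite /monom -!big_split /=;
      apply: eq_bigr => i _.
    by rewrite /u /xi !exprMn; ring.
  have p1 : \prod_i (kn i == k i)%:R = 1 :> R by apply: big1 => i _;
    rewrite /kn eqxx.
  rewrite inner// p1 mul1r [X in _ + X]big1 ?addr0// => l /andP[lN lk];
    rewrite inner//.
  have [i ki] : exists i, k i != l i.
    apply/existsP; apply: contraNT lk => /existsPn h.
    by apply/eqP/ffunP => i; have := h i; rewrite negbK => /eqP.
  by rewrite (bigD1 i)//= /kn -val_eqE /= in ki *; rewrite (negbTE ki) !mul0r.
rewrite -polE -sumrB; apply: le_trans (ler_norm_sum _ _ _) _.
apply: (@le_trans _ _ (\sum_a `|tensor_weight kn a : R| * err)).
  by apply: ler_sum => a _; rewrite -mulrBr normrM ler_wpM2l.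
rewrite -mulr_suml ler_wpM2r ?sum_tensor_weight//.
by rewrite /err mulr_ge0 ?invr_ge0 ?exprn_ge0 ?(le_trans _ rho1) ?expR_ge0.
Qed.

Variables (P Q : probability (Rd R d) R) (PD : P D = 1%E) (QD : Q D = 1%E).

(* V will be a multiple of the total variation (casd_le_TV). *)
Lemma moment_diff_bound (V : R) : 0 <= V ->
  (forall xi : 'I_d -> R, `|\int[P]_t casd xi t - \int[Q]_t casd xi t| <=
     expR ((\sum_i xi i ^+ 2) / 2) * V) ->
  \prod_i (r i ^+ k i / (k i)`!%:R) * `|moment P k - moment Q k| <=
  B * (expR ((\sum_i r i ^+ 2) / 2) * V + 2 * err).
Proof.
move=> V0 hV.
have approx (S : probability (Rd R d) R) : S D = 1%E ->
  `|\sum_a tensor_weight kn a * (\int[S]_t casd (xi a) t) -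
    \prod_i (cas_coeff (k i) * (r i ^+ k i / (k i)`!%:R)) * moment S k| <=
      B * err.
  move=> SD.
  have ic a : S.-integrable setT (EFin \o casd (xi a))
    by exact: integrable_casd.
  have im : S.-integrable setT (EFin \o monom k) by exact: integrable_monom.
  rewrite -(Rintegral_lin xpredT (@tensor_weight R d N kn) ic) /moment
    -RintegralZl//.
  apply: (Rintegral_prob_dist measurable_cube SD);
    last exact: casd_weight_taylor.
    exact: (integrable_lin xpredT (@tensor_weight R d N kn) ic).
  rewrite [X in _ _ _ X](_ : _ = (fun t =>
    (\prod_i (cas_coeff (k i) * (r i ^+ k i / (k i)`!%:R)))%:E
      * (monom k t)%:E)%E)//.
  exact: (integrableZl measurableT _ im).
(* The coefficients of [cas] have modulus one, so dividing by them costs nothing. *)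
have nc : \prod_i (r i ^+ k i / (k i)`!%:R) =
   `|\prod_i (cas_coeff (k i) * (r i ^+ k i / (k i)`!%:R))|.
  rewrite normr_prod; apply: eq_bigr => i _.
  by rewrite normrM norm_cas_coeff mul1r ger0_norm// divr_ge0 ?exprn_ge0.
rewrite nc -normrM mulrBr.
set c := \prod_i (cas_coeff (k i) * _).
set p := c * _; set q := c * _.
have := approx P PD; have := approx Q QD; rewrite -/p -/q.
set sp := \sum_a _; set sq := \sum_a _ => hq hp.
have hs : `|sq - sp| <= B * (expR ((\sum_i r i ^+ 2) / 2) * V).
  rewrite /sp /sq -sumrB; apply: le_trans (ler_norm_sum _ _ _) _.
  apply: (@le_trans _ _ (\sum_a `|tensor_weight kn a : R| *
      (expR ((\sum_i r i ^+ 2) / 2) * V))).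
    apply: ler_sum => a _; rewrite -mulrBr normrM ler_wpM2l//.
    apply: le_trans (hV _) _; rewrite ler_wpM2r// ler_expR ler_wpM2r//.
    apply: ler_sum => i _; rewrite /xi exprMn ler_piMr ?sqr_ge0//.
    by rewrite -(real_normK (num_real _)) expr_le1// cheb_node_le1.
  by rewrite -mulr_suml ler_wpM2r ?mulr_ge0 ?expR_ge0// sum_tensor_weight.
rewrite mulrDr.
have -> : p - q = (sq - sp) - (sq - p) + (sp - q) by ring.
apply: le_trans (ler_normD _ _) _.
apply: le_trans (lerD (ler_normB _ _) (lexx _)) _.
by rewrite -addrA lerD// (mulrCA B 2) mulr_natl mulr2n lerD.
Qed.

End moment_bound.
End moments.

(** * The chi-square divergence *)

Section chi2_bound.
Context {R : realType} {d : nat}.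
Notation mud := (@lebesgue_Rd R d).
Implicit Types (x s t : Rd R d).
Variables (M : R) (hM : 0 < M).
Notation D := (@cube R d M).
Variables (P Q : probability (Rd R d) R) (PD : P D = 1%E) (QD : Q D = 1%E).
Notation f := (gauss_mixture P).
Notation g := (gauss_mixture Q).

(** The squared norm of f - g in L^2(dx / gauss0), expanded; see [integral_sq_dist]. *)
Definition sq_dist : R := gram P P - 2 * gram P Q + gram Q Q.

Lemma sqn_cube t : D t -> sqn t <= d%:R * M ^+ 2.
Proof.
move=> Dt; apply: (@le_trans _ _ (\sum_(i < d) M ^+ 2)).
  by apply: ler_sum => i _; rewrite -(real_normK (num_real _)) lerXn2r ?nnegrE
    ?(ltW hM)// cube_norm.
by rewrite sumr_const card_ord mulr_natl.
Qed.

Lemma sqn_ge0 t : 0 <= sqn t.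
Proof. by apply: sumr_ge0 => i _; exact: sqr_ge0. Qed.

Lemma integrable_kernel (S : probability (Rd R d) R) x :
  S.-integrable setT (EFin \o (fun t => gauss_density (sub_Rd x t))).
Proof.
apply: (@integrable_prob_bounded _ _ _ _ ((Num.sqrt (2 * pi))^-1 ^+ d)).
  exact: measurable_gauss_kernel2.
by move=> t; rewrite ger0_norm ?gauss_density_ge0// gauss_density_le.
Qed.

Lemma mixture_le (S : probability (Rd R d) R) (SD : S D = 1%E) x :
  gauss_mixture S x <= gauss0 x * expR (M * norm1 x).
Proof.
apply: (Rintegral_prob_le (@measurable_cube R d M) SD (integrable_kernel S x))
  => t Dt.
rewrite gauss_density_dot ler_wpM2l ?(ltW (gauss0_gt0 _))// ler_expR.
have := dot_cube x Dt; have := sqn_ge0 t; rewrite ler_norml => h /andP[_ h2];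
  lra.
Qed.

Lemma mixture_ge (S : probability (Rd R d) R) (SD : S D = 1%E) x :
  gauss0 x * expR (- (M * norm1 x) - d%:R * M ^+ 2 / 2) <= gauss_mixture S x.
Proof.
apply: (Rintegral_prob_ge (@measurable_cube R d M) SD (integrable_kernel S x))
  => t Dt.
rewrite gauss_density_dot ler_wpM2l ?(ltW (gauss0_gt0 _))// ler_expR.
have := dot_cube x Dt; have := sqn_cube Dt; rewrite ler_norml => h /andP[h2 _];
  lra.
Qed.

Lemma integrable_prod_gauss0 (S T : probability (Rd R d) R) : S D = 1%E ->
  T D = 1%E ->
  mud.-integrable setT (fun x =>
    (gauss_mixture S x * gauss_mixture T x / gauss0 x)%:E).
Proof.
move=> SD TD; apply/integrableP; split.
  apply/measurable_EFinP; apply: measurable_funM.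
    by apply: measurable_funM; exact: measurable_gauss_mixture.
  by apply: measurable_funV => [|x];
    [exact: measurable_gauss0|rewrite ltW ?gauss0_gt0].
under eq_integral => x _.
  rewrite /= ger0_norm; first over.
  by rewrite !mulr_ge0 ?gauss_mixture_ge0// invr_ge0 ltW ?gauss0_gt0.
by rewrite /= integral_mixture_prod (EFin_gram hM SD TD) ltry.
Qed.

Lemma integral_sq_dist :
  (\int[mud]_x ((f x - g x) ^+ 2 / gauss0 x)%:E = sq_dist%:E)%E.
Proof.
rewrite [LHS](eq_integral (fun x => (f x * f x / gauss0 x)%:E
  - 2%:E * (f x * g x / gauss0 x)%:E
   + (g x * g x / gauss0 x)%:E)%E); last first.
  move=> x _; rewrite -EFinM -EFinB -EFinD; congr EFin.
  by have := gauss0_gt0 x => /lt0r_neq0 h; field.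
have i2 : mud.-integrable setT (fun x => (2%:E * (f x * g x / gauss0 x)%:E)%E).
  exact: (integrableZl measurableT _ (integrable_prod_gauss0 PD QD)).
rewrite integralD//; last 2 first.
- by apply: integrableB => //; exact: integrable_prod_gauss0.
- exact: integrable_prod_gauss0.
rewrite integralB//; last exact: integrable_prod_gauss0.
rewrite (integralZl measurableT (integrable_prod_gauss0 PD QD)).
rewrite !integral_mixture_prod.
by rewrite (EFin_gram hM PD PD) (EFin_gram hM PD QD) (EFin_gram hM QD QD).
Qed.

(** e^(c|y|) <= e^(cy) + e^(-cy), and each term turns the density into a shifted one times
    e^(c^2/2). *)
Lemma integral_gauss1_expabs (c : R) : 0 <= c ->
  (\int[@lebesgue_measure R]_y (gauss1 y * expR (c * `|y|))%:E <=
    (2 * expR (c ^+ 2 / 2))%:E)%E.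
Proof.
move=> c0.
have e2 y : expR (c ^+ 2 / 2) * gauss1 (y - c) + expR (c ^+ 2 / 2) * gauss1
  (y - - c) =
   gauss1 y * (expR (c * y) + expR (- (c * y))).
  rewrite !gauss1D mulrDr; congr (_ + _); rewrite mulrCA -expRD;
    congr (_ * expR _); ring.
have ig m : (\int[@lebesgue_measure R]_y
  (expR (c ^+ 2 / 2) * gauss1 (y - m))%:E =
    (expR (c ^+ 2 / 2))%:E)%E.
  under eq_integral do rewrite EFinM.
  rewrite ge0_integralZl ?lee_fin ?expR_ge0//.
  - by rewrite integral_gauss1 mule1.
  - apply/measurable_EFinP; apply: measurableT_comp;
    first exact: measurable_gauss1.
    exact: measurable_funB.
  - by move=> y _; rewrite lee_fin gauss1_ge0.
have mg m : measurable_fun setT (fun y : R =>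
  (expR (c ^+ 2 / 2) * gauss1 (y - m))%:E).
  apply/measurable_EFinP; apply: measurable_funM => //.
  apply: measurableT_comp; first exact: measurable_gauss1.
  exact: measurable_funB.
have g0 m y : (0 <= (expR (c ^+ 2 / 2) * gauss1 (y - m))%:E)%E.
  by rewrite lee_fin mulr_ge0 ?expR_ge0 ?gauss1_ge0.
rewrite mulr_natl mulr2n EFinD -{1}(ig c) -(ig (- c)) -ge0_integralD//.
apply: ge0_le_integral => //.
- by move=> y _; rewrite lee_fin mulr_ge0 ?expR_ge0 ?gauss1_ge0.
- apply/measurable_EFinP; apply: measurable_funM;
  first exact: measurable_gauss1.
  apply: measurableT_comp => //; apply: measurable_funM => //.
- exact: (emeasurable_funD (mg c) (mg (- c))).
- move=> y _; rewrite -EFinD e2 lee_fin ler_wpM2l ?gauss1_ge0//.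
  have [y0|y0] := leP 0 y.
    by rewrite ger0_norm// lerDl expR_ge0.
  by rewrite ltr0_norm// mulrN lerDr expR_ge0.
- exact: mg.
- exact: mg.
Qed.

Lemma integral_gauss0_exp (c : R) : 0 <= c ->
  (\int[mud]_x (gauss0 x * expR (c * norm1 x))%:E <=
    ((2 * expR (c ^+ 2 / 2)) ^+ d)%:E)%E.
Proof.
move=> c0.
have e x : gauss0 x * expR (c * norm1 x) =
    \prod_(i < d) (gauss1 (tnth x i) * expR (c * `|tnth x i|)).
  by rewrite big_split /= /norm1 mulr_sumr expR_sum.
under eq_integral do rewrite e.
rewrite (ge0_integral_tuple_prod lebesgue_measure
  (g := fun i y => gauss1 y * expR (c * `|y|))).
- have E : (2 * expR (c ^+ 2 / 2)) ^+ d = \prod_(i < d) (2 * expR (c ^+ 2 / 2)).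
    by rewrite prodr_const card_ord.
  have := integral_gauss1_expabs c0; set I := (\int[_]_y _)%E => Ile.
  have I0 : (0 <= I)%E.
    by apply: integral_ge0 => y _;
      rewrite lee_fin mulr_ge0 ?gauss1_ge0 ?expR_ge0.
  have If : I = (fine I)%:E
    by rewrite fineK// ge0_fin_numE// (le_lt_trans Ile)// ltry.
  rewrite E If prodEFin lee_fin; apply: ler_prod => i _.
  by rewrite -2!lee_fin -If I0.
- move=> i; apply: measurable_funM; first exact: measurable_gauss1.
  apply: measurableT_comp => //; apply: measurable_funM => //.
- by move=> i y; rewrite mulr_ge0 ?gauss1_ge0 ?expR_ge0.
Qed.

(** Up to the constant e^(d M^2 / 2), 1/g is at most e^n / gauss0 with n = M |x|_1. Where n <= a
    this costs e^a; elsewhere an exponential tail bound with parameter p applies. In p + 2, the 2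
    comes from bounding (f - g)^2 by (gauss0 e^n)^2. *)
Lemma chi2_le (a p : R) : 1 <= p ->
  (chi2 f g <= (expR (d%:R * M ^+ 2 / 2) * (expR a * sq_dist +
    expR (- ((p - 1) * a)) * (2 * expR (((p + 2) * M) ^+ 2 / 2)) ^+ d))%:E)%E.
Proof.
move=> p1.
have g0p := @gauss0_gt0 R d.
have gp x : 0 < g x by apply: lt_le_trans (mixture_ge QD x);
  rewrite mulr_gt0 ?expR_gt0.
set K := expR (d%:R * M ^+ 2 / 2).
set c := (p + 2) * M.
have c0 : 0 <= c by rewrite mulr_ge0 ?(ltW hM)//; lra.
have pt x : (f x - g x) ^+ 2 / g x <=
  K * expR a * ((f x - g x) ^+ 2 / gauss0 x) +
    K * expR (- ((p - 1) * a)) * (gauss0 x * expR (c * norm1 x)).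
  set s := (f x - g x) ^+ 2; set n := M * norm1 x.
  have n0 : 0 <= n by rewrite mulr_ge0 ?norm1_ge0// ltW.
  have s0 : 0 <= s by exact: sqr_ge0.
  have s1 : s <= (gauss0 x * expR n) ^+ 2.
    rewrite /s -(real_normK (num_real _)) lerXn2r ?nnegrE ?mulr_ge0 ?expR_ge0
      ?(ltW (g0p x))//.
    have := mixture_le PD x; have := mixture_le QD x.
    have := gauss_mixture_ge0 P x; have := gauss_mixture_ge0 Q x.
    rewrite -/n ler_norml; lra.
  have h1 : s / g x <= K * expR n * (s / gauss0 x).
    rewrite ler_pdivrMr//; have := mixture_ge QD x; rewrite -/n => hg.
    have -> : K * expR n * (s / gauss0 x) * g x =
      s * (K * expR n * (g x / gauss0 x)).
      by have := lt0r_neq0 (g0p x) => ?; field.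
    rewrite ler_peMr//;
      rewrite -[leLHS](_ : K * expR n * expR (- n - d%:R * M ^+ 2 / 2) = 1).
      by rewrite ler_wpM2l ?mulr_ge0 ?expR_ge0// ler_pdivlMr// mulrC.
    by rewrite /K -!expRD -[RHS]expR0; congr expR; ring.
  (* Absorbs the weight: either n <= a, or n <= p n - (p - 1) a. *)
  have h2 : expR n <= expR a + expR (p * n - (p - 1) * a).
    have [na|an] := leP n a.
      by rewrite -[leLHS]addr0 lerD ?ler_expR// expR_ge0.
    rewrite -[leLHS]add0r lerD ?expR_ge0// ler_expR; nra.
  apply: (le_trans h1);
    apply: (@le_trans _ _ (K * (expR a + expR (p * n - (p - 1) * a))
      * (s / gauss0 x))).
    by rewrite ler_wpM2r ?ler_wpM2l ?expR_ge0// mulr_ge0 ?invr_ge0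
      ?(ltW (g0p x)).
  rewrite mulrDr mulrDl lerD2l.
  apply: (@le_trans _ _
    (K * expR (p * n - (p - 1) * a) * (gauss0 x * expR (n *+ 2)))).
    rewrite ler_wpM2l ?mulr_ge0 ?expR_ge0// ler_pdivrMr// (le_trans s1)//.
    by rewrite exprMn -expRM_natl mulr_natl expr2 mulrAC.
  rewrite le_eqVlt; apply/orP; left; apply/eqP.
  have -> : K * expR (p * n - (p - 1) * a) * (gauss0 x * expR (n *+ 2)) =
      K * gauss0 x * (expR (p * n - (p - 1) * a) * expR (n *+ 2)) by ring.
  have -> : K * expR (- ((p - 1) * a)) * (gauss0 x * expR (c * norm1 x)) =
      K * gauss0 x * (expR (- ((p - 1) * a)) * expR (c * norm1 x)) by ring.
  by rewrite -!expRD; congr (_ * expR _); rewrite /c /n; ring.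
have mg0V : measurable_fun setT (fun x => (@gauss0 R d x)^-1).
  by apply: measurable_funV => [|x]; [exact: measurable_gauss0|rewrite ltW].
have mfg : measurable_fun setT (fun x => (f x - g x) ^+ 2).
  apply: measurable_funX; apply: measurable_funB;
    exact: measurable_gauss_mixture.
have m1 : measurable_fun setT (fun x => ((f x - g x) ^+ 2 / gauss0 x)%:E).
  by apply/measurable_EFinP; exact: measurable_funM.
have m2 : measurable_fun setT (fun x => (gauss0 x * expR (c * norm1 x))%:E).
  apply/measurable_EFinP; apply: measurable_funM;
    first exact: measurable_gauss0.
  apply: measurableT_comp => //; apply: measurable_funM => //.
  apply: measurable_sum => i; apply: measurableT_comp => //;
    exact: measurable_coord.
have n1 x : (0 <= ((f x - g x) ^+ 2 / gauss0 x)%:E)%E.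
  by rewrite lee_fin mulr_ge0 ?sqr_ge0// invr_ge0 ltW.
have n2 x : (0 <= (gauss0 x * expR (c * norm1 x))%:E)%E.
  by rewrite lee_fin mulr_ge0 ?expR_ge0// ltW.
set A1 := K * expR a; set A2 := K * expR (- ((p - 1) * a)).
have A10 : (0 <= A1%:E)%E by rewrite lee_fin mulr_ge0 ?expR_ge0.
have A20 : (0 <= A2%:E)%E by rewrite lee_fin mulr_ge0 ?expR_ge0.
apply: (@le_trans _ _ (\int[mud]_x (A1%:E * ((f x - g x) ^+ 2 / gauss0 x)%:E +
    A2%:E * (gauss0 x * expR (c * norm1 x))%:E))%E).
  apply: ge0_le_integral => //.
  - by move=> x _; rewrite lee_fin mulr_ge0 ?sqr_ge0// invr_ge0 ltW.
  - apply/measurable_EFinP; apply: measurable_funM => //.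
    by apply: measurable_funV => [|x];
      [exact: measurable_gauss_mixture|rewrite ltW].
  - by apply: emeasurable_funD; apply: measurable_funeM.
  - by move=> x _; rewrite -!EFinM -EFinD lee_fin; exact: pt.
rewrite ge0_integralD//; last 4 first.
- by move=> x _; rewrite mule_ge0.
- exact: measurable_funeM.
- by move=> x _; rewrite mule_ge0.
- exact: measurable_funeM.
rewrite !ge0_integralZl// integral_sq_dist.
have -> : K * (expR a * sq_dist + expR (- ((p - 1) * a))
  * (2 * expR (c ^+ 2 / 2)) ^+ d) =
    A1 * sq_dist + A2 * (2 * expR (c ^+ 2 / 2)) ^+ d by rewrite /A1 /A2; ring.
rewrite [leRHS]EFinD; apply: leeD; rewrite [leRHS]EFinM//.
by rewrite lee_wpmul2l// integral_gauss0_exp.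
Qed.

End chi2_bound.

(** * A weak Stirling bound and the margin between 5/2 and e *)

Section elementary.
Context {R : realType}.

(** The induction step is e (k+1)^(k+2) <= (k+2)^(k+2), a power of 1 - x <= e^(-x) at x =
    1/(k+2). *)
Lemma fact_expR_le (k : nat) :
  k`!%:R * expR k%:R <= expR 1 * k.+1%:R * k%:R ^+ k :> R.
Proof.
case: k => [|k]; first by rewrite fact0 expR0 !mul1r expr0 mulr1 mulr1
  -[leLHS]expR0 ler_expR.
(* For positive arguments the factor can be the argument itself; the extra one in the statement is
   there for 0. *)
suff : k.+1`!%:R * expR k.+1%:R <= expR 1 * k.+1%:R * k.+1%:R ^+ k.+1 :> R.
  move=> /le_trans; apply; rewrite ler_wpM2r ?exprn_ge0// ler_wpM2l ?expR_ge0//.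
  by rewrite ler_nat.
elim: k => [|k IH]; first by rewrite mul1r expr1 !mulr1.
have k0 : 0 < k.+1%:R :> R by rewrite ltr0n.
have k1 : 0 < k.+2%:R :> R by rewrite ltr0n.
have e1 : expR 1 * k.+1%:R ^+ k.+2 <= k.+2%:R ^+ k.+2 :> R.
  have h : expR (k.+2%:R^-1) * k.+1%:R <= k.+2%:R :> R.
    rewrite -[k.+2%:R^-1]opprK expRN mulrC ler_pdivrMr ?expR_gt0//.
    apply: (@le_trans _ _ (k.+2%:R * (1 + - k.+2%:R^-1))); last first.
      by rewrite ler_wpM2l ?expR_ge1Dx// ltW.
    by rewrite mulrDr mulr1 mulrN mulfV ?lt0r_neq0// -[k.+2%:R]natr1 addrK.
  have : (expR (k.+2%:R^-1) * k.+1%:R) ^+ k.+2 <= k.+2%:R ^+ k.+2 :> R.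
    by rewrite lerXn2r ?nnegrE ?mulr_ge0 ?expR_ge0.
  by rewrite exprMn -expRM_natl mulfV ?lt0r_neq0.
have -> : expR k.+2%:R = expR k.+1%:R * expR 1 :> R by rewrite -expRD natr1.
rewrite factS natrM.
have -> : k.+2%:R * k.+1`!%:R * (expR k.+1%:R * expR 1) =
  k.+2%:R * expR 1 * (k.+1`!%:R * expR k.+1%:R) :> R by ring.
apply: (@le_trans _ _
  (k.+2%:R * expR 1 * (expR 1 * k.+1%:R * k.+1%:R ^+ k.+1))).
  by rewrite ler_wpM2l ?mulr_ge0 ?expR_ge0.
have -> : k.+2%:R * expR 1 * (expR 1 * k.+1%:R * k.+1%:R ^+ k.+1) =
  expR 1 * k.+2%:R * (expR 1 * k.+1%:R ^+ k.+2) :> R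
    by rewrite [_ ^+ k.+2]exprS; ring.
by rewrite ler_wpM2l ?mulr_ge0 ?expR_ge0.
Qed.

(** The value 1/50 is small enough for the estimate e >= (9/8)^8 to suffice. This margin is spent in
    [chi2_le_TV_decay]. *)
Lemma expR1_lb : 5 / 2 * expR (50^-1) <= expR 1 :> R.
Proof.
have h8 : 9 / 8 <= expR (8^-1) :> R by apply: le_trans (expR_ge1Dx _); lra.
have e1 : (9 / 8) ^+ 8 <= expR 1 :> R.
  have -> : expR 1 = expR (8^-1) ^+ 8 :> R by rewrite -expRM_natl mulfV.
  by rewrite lerXn2r ?nnegrE ?expR_ge0//; lra.
have e50 : expR (50^-1) <= 50 / 49 :> R.
  rewrite -[50^-1]opprK expRN -[leRHS]invrK lef_pV2 ?posrE ?expR_gt0//.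
  by apply: le_trans (expR_ge1Dx _); rewrite (_ : (50 / 49)^-1 = 1 - 50^-1)//;
    field.
lra.
Qed.

Lemma exp_poly_bound (m : nat) (s : R) : 0 < s ->
  exists2 C : R, 0 < C & forall N : nat, N.+2%:R ^+ m <= C * expR (s * N%:R).
Proof.
move=> s0; exists (m`!%:R * s ^- m * expR (s * 2)).
  by rewrite !mulr_gt0 ?expR_gt0 ?invr_gt0 ?exprn_gt0// ltr0n fact_gt0.
move=> N; rewrite -[leRHS]mulrA -expRD -mulrDr -natrD add2n.
have x0 : 0 <= s * N.+2%:R by rewrite mulr_ge0// ltW.
have : (s * N.+2%:R) ^+ m / m`!%:R <= expR (s * N.+2%:R).
  apply: le_trans (sum_exp_coeff_le m.+1 x0).
  by rewrite big_ord_recr /= lerDr; apply: sumr_ge0 => i _;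
    rewrite divr_ge0 ?exprn_ge0.
rewrite ler_pdivrMr ?ltr0n ?fact_gt0// exprMn => h.
rewrite mulrAC mulrC ler_pdivlMl ?exprn_gt0// mulrC.
by rewrite mulrC (le_trans h)// mulrC.
Qed.

End elementary.

(** * The weighted L^2 distance in terms of total variation *)

Section gram_bound.
Context {R : realType} {d : nat}.
Variables (M : R) (hM : 0 < M).
Notation D := (@cube R d M).

(** N^(-N/2) e^(bN), with a square root in place of a real exponent. *)
Definition decay (b : R) (N : nat) : R := Num.sqrt N%:R ^- N * expR (b * N%:R).

Lemma decay_ge0 b N : 0 <= decay b N.
Proof. by rewrite mulr_ge0 ?expR_ge0 ?invr_ge0 ?exprn_ge0. Qed.

Lemma decay_le b b' N : b <= b' -> decay b N <= decay b' N.
Proof.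
by move=> bb; rewrite ler_wpM2l ?invr_ge0 ?exprn_ge0// ler_expR ler_wpM2r.
Qed.

Lemma decay_sqr b N : decay b N ^+ 2 = N%:R ^- N * expR (2 * b * N%:R).
Proof.
rewrite exprMn exprVn -exprM mulnC exprM sqr_sqrtr//.
by rewrite -expRM_natl mulrA.
Qed.

Variables (P Q : probability (Rd R d) R) (PD : P D = 1%E) (QD : Q D = 1%E).

(** The left side is the product of the k_i! / k_i^k_i times X^2, where X is what
    [moment_diff_bound] controls. [fact_expR_le] cancels the factor e^|k| in that control. *)
Lemma moment_term_bound N (k : {ffun 'I_d -> 'I_N.+2}) (V : R) :
  (0 < N)%N -> (\sum_i k i <= N)%N -> 0 <= V ->
  (forall xi : 'I_d -> R, `|\int[P]_t casd xi t - \int[Q]_t casd xi t| <=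
     expR ((\sum_i xi i ^+ 2) / 2) * V) ->
  \prod_i (k i)`!%:R^-1 * (moment P k - moment Q k) ^+ 2 <=
  (N.+1%:R ^+ d * 2 ^+ d * (5 / 2) ^+ N) ^+ 2 * (expR 1 * N.+1%:R) ^+ d *
    (V + 2 * decay (d%:R * M) N) ^+ 2.
Proof.
move=> N0 kN V0 hV; set B := _ * _ * (5 / 2) ^+ N; set eta := decay _ N.
have eta0 : 0 <= eta by exact: decay_ge0.
(* On this box exp(|xi|^2 / 2) = e^(|k| / 2) is offset by k! ~ (k / e)^k. *)
pose r i : R := Num.sqrt (k i)%:R.
(* The radius sqrt(N) has the size of the frequencies: rho^(-N-1) supplies N^(-N/2), while rho M
   (r_1 + ... + r_d) <= d M N remains linear in N. *)
have rho1 : 1 <= Num.sqrt N%:R :> R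
  by rewrite -[leLHS]sqrtr1 ler_wsqrtr// ler1n.
have rho0 : 0 < Num.sqrt N%:R :> R by rewrite (lt_le_trans _ rho1).
have kiN i : (k i <= N)%N by apply: leq_trans kN; rewrite (bigD1 i)//= leq_addr.
have r0 i : 0 <= r i by exact: sqrtr_ge0.
have := moment_diff_bound hM kN r0 rho1 PD QD V0 hV; rewrite -/B.
set X := \prod_i _ * _; set K := \sum_i (k i : nat).
have -> : \sum_i r i ^+ 2 = K%:R.
  by rewrite /K natr_sum; apply: eq_bigr => i _; rewrite sqr_sqrtr.
set err := _ * expR (Num.sqrt _ * _).
have err_le : err <= eta.
  rewrite /err /eta /decay ler_pM ?invr_ge0 ?exprn_ge0 ?expR_ge0 ?sqrtr_ge0//.
    by rewrite lef_pV2 ?posrE ?exprn_gt0// ler_weXn2l.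
  rewrite ler_expR (_ : d%:R * M * N%:R = M * (d%:R * N%:R)); last by ring.
  rewrite mulrCA ler_wpM2l ?(ltW hM)//.
  rewrite mulr_sumr; apply: (@le_trans _ _ (\sum_(i < d) N%:R)).
    apply: ler_sum => i _; rewrite -[leRHS](@sqr_sqrtr R) ?ler0n// expr2.
    by rewrite ler_wpM2l ?sqrtr_ge0// ler_wsqrtr// ler_nat.
  by rewrite sumr_const card_ord mulr_natl.
move=> hX.
have B0 : 0 <= B by rewrite /B !mulr_ge0 ?exprn_ge0//; lra.
have X0 : 0 <= X.
  by rewrite /X mulr_ge0// prodr_ge0// => i _; rewrite divr_ge0 ?exprn_ge0.
have hX2 : X ^+ 2 <= B ^+ 2 * expR K%:R * (V + 2 * eta) ^+ 2.
  have -> : B ^+ 2 * expR K%:R * (V + 2 * eta) ^+ 2 =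
     (B * (expR (K%:R / 2) * (V + 2 * eta))) ^+ 2.
    have e2 : expR (K%:R / 2) ^+ 2 = expR K%:R :> R
      by rewrite -expRM_natl mulrC divfK.
    by rewrite -e2; ring.
  have Y0 : 0 <= B * (expR (K%:R / 2) * (V + 2 * eta)).
    by rewrite mulr_ge0// mulr_ge0 ?expR_ge0// addr_ge0// mulr_ge0.
  rewrite lerXn2r ?nnegrE//.
  apply: (le_trans hX); rewrite ler_wpM2l// mulrDr lerD2l.
  apply: (@le_trans _ _ (1 * (2 * eta))); first by rewrite mul1r ler_wpM2l.
  by rewrite ler_wpM2r ?mulr_ge0// -[leLHS]expR0 ler_expR divr_ge0.
(* Coordinates with k_i = 0 are covered by the convention 0^0 = 1. *)
have kk0 (n : nat) : 0 < n%:R ^+ n :> R.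
  by case: n => [|n]; [rewrite expr0|rewrite exprn_gt0// ltr0n].
have f0 (n : nat) : n`!%:R != 0 :> R by rewrite pnatr_eq0 -lt0n fact_gt0.
have Xe : X ^+ 2 = \prod_i ((k i)%:R ^+ k i / (k i)`!%:R ^+ 2) *
    (moment P k - moment Q k) ^+ 2.
  rewrite /X [LHS]exprMn real_normK ?num_real//; congr (_ * _).
  rewrite -prodrXl; apply: eq_bigr => i _.
  by rewrite expr_div_n -exprM mulnC exprM sqr_sqrtr.
have -> : \prod_i (k i)`!%:R^-1 * (moment P k - moment Q k) ^+ 2 =
    \prod_i ((k i)`!%:R / (k i)%:R ^+ k i) * X ^+ 2.
  rewrite Xe mulrA; congr (_ * _); rewrite -big_split /=; apply: eq_bigr => i _.
  by field; rewrite f0 gt_eqF.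
apply: (@le_trans _ _ (\prod_i ((k i)`!%:R / (k i)%:R ^+ k i) *
   (B ^+ 2 * expR K%:R * (V + 2 * eta) ^+ 2))).
  by rewrite ler_wpM2l// prodr_ge0// => i _; rewrite divr_ge0 ?exprn_ge0.
have -> : \prod_i ((k i)`!%:R / (k i)%:R ^+ k i) *
   (B ^+ 2 * expR K%:R * (V + 2 * eta) ^+ 2) =
   B ^+ 2 * (\prod_i ((k i)`!%:R / (k i)%:R ^+ k i) * expR K%:R)
     * (V + 2 * eta) ^+ 2.
  by ring.
rewrite ler_wpM2r ?sqr_ge0// ler_wpM2l ?sqr_ge0//.
rewrite /K natr_sum expR_sum -big_split /= -[X in _ ^+ X](card_ord d)
  -prodr_const.
apply: ler_prod => i _; apply/andP; split.
  by rewrite !mulr_ge0 ?expR_ge0// invr_ge0 exprn_ge0.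
rewrite mulrAC ler_pdivrMr//; apply: le_trans (fact_expR_le _) _.
by rewrite ler_wpM2r ?(ltW (kk0 _))// ler_wpM2l ?expR_ge0// ler_nat ltnS.
Qed.

Local Notation T := (TV (gauss_mixture P) (gauss_mixture Q)).

(** The three truncated Gram sums combine into a sum of squares over at most (N+2)^d indices, each
    bounded by [moment_term_bound]. The 4 is 1 + 2 + 1 truncation errors. *)
Lemma sq_dist_bound N : (0 < N)%N ->
  sq_dist P Q <= N.+2%:R ^+ d *
    ((N.+1%:R ^+ d * 2 ^+ d * (5 / 2) ^+ N) ^+ 2 * (expR 1 * N.+1%:R) ^+ d *
    (2 ^+ d * (2 * T) + 2 * decay (d%:R * M) N) ^+ 2) +
    4 * decay (d%:R * M ^+ 2) N ^+ 2.
Proof.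
move=> N0.
have N1 : 1 <= N%:R :> R by rewrite ler1n.
have T0 : 0 <= T by rewrite /TV mulr_ge0 ?invr_ge0// Rintegral_ge0.
have V0 : 0 <= 2 ^+ d * (2 * T) by rewrite mulr_ge0 ?exprn_ge0// mulr_ge0.
pose low := (fun k : {ffun 'I_d -> 'I_N.+2} => (\sum_i k i <= N)%N).
pose S (P1 P2 : probability (Rd R d) R) :=
  \sum_(k : {ffun 'I_d -> 'I_N.+2} | low k)
     \prod_i (k i)`!%:R^-1 * moment P1 k * moment P2 k.
(* Here the Taylor radius is N: the cube is fixed, and the error has to reach the square of
   N^(-N/2). *)
pose e : R := N%:R ^- N.+1 * expR (N%:R * (d%:R * M ^+ 2)).
have gPP : `|gram P P - S P P| <= e by exact: (gram_taylor hM PD PD N N1).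
have gPQ : `|gram P Q - S P Q| <= e by exact: (gram_taylor hM PD QD N N1).
have gQQ : `|gram Q Q - S Q Q| <= e by exact: (gram_taylor hM QD QD N N1).
have e_le : e <= decay (d%:R * M ^+ 2) N ^+ 2.
  rewrite decay_sqr /e ler_pM ?invr_ge0 ?exprn_ge0 ?expR_ge0//.
    by rewrite lef_pV2 ?posrE ?exprn_gt0 ?(lt_le_trans _ N1)// ler_weXn2l.
  rewrite ler_expR; have c0 : 0 <= d%:R * M ^+ 2 by rewrite mulr_ge0 ?sqr_ge0.
  have := mulr_ge0 (ler0n R N) c0; lra.
have SE : S P P - 2 * S P Q + S Q Q = \sum_(k : {ffun 'I_d -> 'I_N.+2} | low k)
    \prod_i (k i)`!%:R^-1 * (moment P k - moment Q k) ^+ 2.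
  rewrite /S mulr_sumr -sumrB -big_split /=; apply: eq_bigr => k _; ring.
have Sle : S P P - 2 * S P Q + S Q Q <= N.+2%:R ^+ d *
    ((N.+1%:R ^+ d * 2 ^+ d * (5 / 2) ^+ N) ^+ 2 * (expR 1 * N.+1%:R) ^+ d *
    (2 ^+ d * (2 * T) + 2 * decay (d%:R * M) N) ^+ 2).
  set W := (X in _ <= _ * X).
  have W0 : 0 <= W.
    rewrite /W; apply: mulr_ge0; last exact: sqr_ge0.
    by apply: mulr_ge0; [exact: sqr_ge0|rewrite exprn_ge0// mulr_ge0 ?expR_ge0].
  rewrite SE; apply: (@le_trans _ _ (\sum_(k : {ffun 'I_d -> 'I_N.+2} | low k)
    W)).
    apply: ler_sum => k kN; apply: moment_term_bound => // xi.
    exact: casd_le_TV.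
  rewrite sumr_const -[leLHS]mulr_natl ler_wpM2r// -natrX ler_nat.
  by rewrite (leq_trans (max_card _))// card_ffun !card_ord.
move: gPP gPQ gQQ; rewrite !ler_norml => /andP[_ h1] /andP[h2 _] /andP[_ h3].
rewrite /sq_dist; lra.
Qed.
End gram_bound.

Section uniform_bound.
Context {R : realType} {d : nat}.
Variables (M : R) (hM : 0 < M).
Notation D := (@cube R d M).

(** Keeps the cost e^(O(log^2 N)) of the exponential tail bound inside a factor e^(O(N)) of
    [decay]. *)
Lemma ln_sqr_le (n : nat) : (0 < n)%N -> ln n%:R ^+ 2 <= 4 * n%:R :> R.
Proof.
move=> n0; have n1 : 1 <= n%:R :> R by rewrite ler1n.
have s0 : 0 < Num.sqrt n%:R :> R by rewrite sqrtr_gt0 (lt_le_trans _ n1).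
have nE : n%:R = Num.sqrt n%:R ^+ 2 :> R by rewrite sqr_sqrtr// (le_trans _ n1).
have lnE : ln n%:R = 2 * ln (Num.sqrt n%:R) :> R
  by rewrite {1}nE lnXn// mulr_natl.
rewrite lnE [in leRHS]nE exprMn.
rewrite (_ : 2 ^+ 2 = 4 :> R); last by ring.
rewrite ler_wpM2l// lerXn2r ?nnegrE ?(ltW s0) ?(ltW (ln_sublinear s0))//.
by rewrite ln_ge0// -[leLHS]sqrtr1 ler_wsqrtr.
Qed.

(** The constants are fixed before the measures and N, so the degree may later be chosen from the
    total variation. *)
Lemma chi2_le_TV_decay : exists C b : R, [/\ 0 < C, 0 <= b &
  forall P Q : probability (Rd R d) R, P D = 1%E -> Q D = 1%E ->
  forall N, (0 < N)%N ->
  (sqrte (chi2 (gauss_mixture P) (gauss_mixture Q)) <=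
   (C * expR N%:R * (TV (gauss_mixture P) (gauss_mixture Q) +
     decay b N))%:E)%E].
Proof.
have h0 : 0 <= 5 / 2 :> R by lra.
have d4 : (4 * d = d + d * 2 + d)%N by lia.
have [q q1 hq] : exists2 q : R, 1 <= q & 5 / 2 * expR (q^-1) <= expR 1.
  by exists 50; [lra|exact: expR1_lb].
have q0 : 0 < q by rewrite (lt_le_trans _ q1).
have s0 : 0 < q^-1 by rewrite invr_gt0.
(* The degree 4d counts d for the number of multi-indices, 2d for the squared weight sum and d for
   the Stirling factors. *)
have [C4 C40 hC4] := exp_poly_bound (4 * d) s0.
pose m2 := d%:R * M ^+ 2.
have m20 : 0 <= m2 by rewrite mulr_ge0 ?sqr_ge0.
have dM0 : 0 <= d%:R * M by rewrite mulr_ge0 ?(ltW hM).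
have qm0 : 0 <= 2 * q ^+ 2 * m2 by rewrite mulr_ge0// mulr_ge0 ?sqr_ge0.
(* chi2_le is used with a = N / q and p = 1 + q ln N. *)
pose b := d%:R * M + 2 * q ^+ 2 * m2.
pose K := expR (m2 / 2).
pose c1 : R := 4 ^+ d * expR 1 ^+ d * (2 * 2 ^+ d) ^+ 2 + 4.
pose c2 : R := 2 ^+ d * expR (9 * m2).
pose Cc := K * (c1 + c2) * C4.
have c10 : 0 < c1 by rewrite /c1 ltr_wpDl// !mulr_ge0 ?exprn_ge0 ?sqr_ge0
  ?expR_ge0.
have c20 : 0 < c2 by rewrite /c2 mulr_gt0 ?exprn_gt0 ?expR_gt0.
have Cc0 : 0 < Cc by rewrite /Cc !mulr_gt0 ?expR_gt0 ?addr_gt0.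
exists (Num.sqrt Cc), b; split.
- by rewrite sqrtr_gt0.
- by rewrite /b addr_ge0.
move=> P Q PD QD N N0.
set T := TV _ _; set eta := decay b N.
have T0 : 0 <= T by rewrite /T /TV mulr_ge0 ?invr_ge0// Rintegral_ge0.
have eta0 : 0 <= eta by exact: decay_ge0.
have N1 : 1 <= N%:R :> R by rewrite ler1n.
have lnN0 : 0 <= ln N%:R :> R by exact: ln_ge0.
pose A : R := N.+2%:R ^+ (4 * d) * (5 / 2) ^+ (2 * N).
have A1 : 1 <= A.
  have h1 : 1 <= N.+2%:R ^+ (4 * d) :> R by rewrite exprn_ege1// ler1n.
  have h2 : 1 <= (5 / 2) ^+ (2 * N) :> R by rewrite exprn_ege1//; lra.
  by rewrite /A -[leLHS]mul1r ler_pM.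
have d1 : decay (d%:R * M) N <= eta.
  by apply: decay_le; rewrite /b lerDl.
have d2 : decay (2 * q ^+ 2 * m2) N <= eta by apply: decay_le; rewrite /b lerDr.
have d3 : decay m2 N <= eta.
  apply: le_trans d2; apply: decay_le; rewrite ler_peMl//.
  have := exprn_ege1 2 q1; lra.
have sq_le : sq_dist P Q <= c1 * A * (T + eta) ^+ 2.
  apply: le_trans (sq_dist_bound hM PD QD N0) _; rewrite -/T -/m2.
  have -> : c1 * A * (T + eta) ^+ 2 = 4 ^+ d * expR 1 ^+ d * (2 * 2 ^+ d) ^+ 2
    * A *
     (T + eta) ^+ 2 + 4 * (A * (T + eta) ^+ 2) by rewrite /c1; ring.
  apply: lerD; last first.
    rewrite ler_wpM2l//; apply: (@le_trans _ _ ((T + eta) ^+ 2)); last first.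
      by rewrite ler_peMl// sqr_ge0.
    rewrite lerXn2r ?nnegrE ?decay_ge0 ?addr_ge0//.
    by apply: (le_trans d3); rewrite lerDr.
  have VT : 2 ^+ d * (2 * T) + 2 * decay (d%:R * M) N <= 2 * 2 ^+ d * (T + eta).
    rewrite mulrDr; apply: lerD; first by rewrite mulrCA mulrA.
    apply: ler_pM => //; first exact: decay_ge0.
    by rewrite ler_peMr// exprn_ege1// ler1n.
  have VT2 : (2 ^+ d * (2 * T) + 2 * decay (d%:R * M) N) ^+ 2 <=
      (2 * 2 ^+ d) ^+ 2 * (T + eta) ^+ 2.
    rewrite -exprMn lerXn2r ?nnegrE//.
      by rewrite addr_ge0//;
        [rewrite mulr_ge0 ?exprn_ge0// mulr_ge0|rewrite mulr_ge0 ?decay_ge0].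
    by rewrite mulr_ge0 ?addr_ge0// mulr_ge0 ?exprn_ge0.
  have n12 : N.+1%:R <= N.+2%:R :> R by rewrite ler_nat.
  have polyle : N.+2%:R ^+ d * ((N.+1%:R ^+ d * 2 ^+ d * (5 / 2) ^+ N) ^+ 2 *
      (expR 1 * N.+1%:R) ^+ d) <= 4 ^+ d * expR 1 ^+ d * A.
    have -> : 4 ^+ d * expR 1 ^+ d * A = N.+2%:R ^+ d *
       ((N.+2%:R ^+ d * 2 ^+ d * (5 / 2) ^+ N) ^+ 2 * (expR 1 * N.+2%:R) ^+ d).
      have x4 : N.+2%:R ^+ (4 * d) = N.+2%:R ^+ d * (N.+2%:R ^+ d) ^+ 2
        * N.+2%:R ^+ d :> R.
        by rewrite d4 !exprD exprM.
      have h2 : (5 / 2) ^+ (2 * N) = ((5 / 2) ^+ N) ^+ 2 :> R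
        by rewrite mulnC exprM.
      have f4 : 4 ^+ d = (2 ^+ d) ^+ 2 :> R.
        by rewrite -exprM mulnC exprM; congr (_ ^+ d); ring.
      by rewrite /A x4 h2 f4 (exprMn d (expR 1)); ring.
    rewrite ler_wpM2l ?exprn_ge0//; apply: ler_pM.
    - exact: sqr_ge0.
    - by rewrite exprn_ge0// mulr_ge0 ?expR_ge0.
    - rewrite lerXn2r ?nnegrE ?mulr_ge0 ?exprn_ge0//.
      rewrite ler_wpM2r ?exprn_ge0//.
      by rewrite ler_wpM2r ?exprn_ge0// lerXn2r ?nnegrE.
    - rewrite lerXn2r ?nnegrE ?mulr_ge0 ?expR_ge0//.
      by rewrite ler_wpM2l ?expR_ge0.
  rewrite mulrA; apply: (@le_trans _ _ (4 ^+ d * expR 1 ^+ d * A *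
      ((2 * 2 ^+ d) ^+ 2 * (T + eta) ^+ 2))).
    apply: ler_pM => //; last exact: sqr_ge0.
  by rewrite le_eqVlt; apply/orP; left; apply/eqP; ring.
have tail_le : expR (- ((1 + q * ln N%:R - 1) * (q^-1 * N%:R))) *
    (2 * expR (((1 + q * ln N%:R + 2) * M) ^+ 2 / 2)) ^+ d <=
      c2 * (T + eta) ^+ 2.
  (* The choice of a and p makes the tail factor exactly N^(-N), the scale of the square of
     [decay]. *)
  have -> : (1 + q * ln N%:R - 1) * (q^-1 * N%:R) = N%:R * ln N%:R.
    by field; rewrite gt_eqF.
  have -> : expR (- (N%:R * ln N%:R)) = N%:R ^- N :> R.
    by rewrite expRN expRM_natl lnK// posrE (lt_le_trans _ N1).
  rewrite exprMn -expRM_natl.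
  (* From (3 + z)^2 / 2 <= 9 + z^2 at z = q ln N, followed by [ln_sqr_le]. *)
  have hexp : d%:R * (((1 + q * ln N%:R + 2) * M) ^+ 2 / 2) <=
      9 * m2 + 2 * (2 * q ^+ 2 * m2) * N%:R.
    have -> : d%:R * (((1 + q * ln N%:R + 2) * M) ^+ 2 / 2) =
      m2 * ((3 + q * ln N%:R) ^+ 2 / 2) by rewrite /m2; field.
    have -> : 9 * m2 + 2 * (2 * q ^+ 2 * m2) * N%:R =
      m2 * (9 + q ^+ 2 * (4 * N%:R)) by ring.
    rewrite ler_wpM2l//.
    have := ler_wpM2l (sqr_ge0 q) (ln_sqr_le N0); rewrite -exprMn.
    have := sqr_ge0 (3 - q * ln N%:R); set z := q * ln _; set w := q ^+ 2 * _.
    rewrite (_ : (3 - z) ^+ 2 = 9 - 6 * z + z ^+ 2); last by ring.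
    rewrite (_ : (3 + z) ^+ 2 = 9 + 6 * z + z ^+ 2); last by ring.
    lra.
  apply: (@le_trans _ _ (c2 * decay (2 * q ^+ 2 * m2) N ^+ 2)).
    apply: (@le_trans _ _ (2 ^+ d * (N%:R ^- N *
        (expR (9 * m2) * expR (2 * (2 * q ^+ 2 * m2) * N%:R))))).
      rewrite mulrCA; apply: ler_wpM2l; first exact: exprn_ge0.
      apply: ler_wpM2l; first by rewrite invr_ge0 exprn_ge0.
      by rewrite -expRD ler_expR.
    by rewrite decay_sqr /c2 le_eqVlt; apply/orP; left; apply/eqP; ring.
  rewrite ler_wpM2l ?(ltW c20)// lerXn2r ?nnegrE ?decay_ge0 ?addr_ge0//.
  by apply: (le_trans d2); rewrite lerDr.
have e0 : 0 <= Num.sqrt Cc * expR N%:R * (T + eta).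
  by rewrite mulr_ge0 ?addr_ge0// mulr_ge0 ?sqrtr_ge0 ?expR_ge0.
rewrite -[leRHS](_ : sqrte ((Num.sqrt Cc * expR N%:R * (T + eta)) ^+ 2)%:E =
  _); last first.
  by rewrite EFin_expe sqrte_sqr gee0_abs.
rewrite lee_sqrt ?lee_fin ?sqr_ge0//.
have p1 : 1 <= 1 + q * ln N%:R :> R by rewrite lerDl mulr_ge0// ltW.
apply: le_trans (chi2_le hM PD QD (q^-1 * N%:R) p1) _; rewrite lee_fin -/m2 -/K.
have T2 : 0 <= (T + eta) ^+ 2 by exact: sqr_ge0.
have eN1 : 1 <= expR (q^-1 * N%:R) :> R
  by rewrite -[leLHS]expR0 ler_expR mulr_ge0// ltW.
apply: (@le_trans _ _
  (K * ((c1 + c2) * (expR (q^-1 * N%:R) * A * (T + eta) ^+ 2)))).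
  rewrite ler_wpM2l ?expR_ge0// [leRHS]mulrDl; apply: lerD.
    apply: le_trans (ler_wpM2l (expR_ge0 _) sq_le) _.
    by rewrite le_eqVlt; apply/orP; left; apply/eqP; ring.
  apply: (le_trans tail_le); rewrite ler_wpM2l ?(ltW c20)// ler_peMl//.
  by rewrite -[leLHS]mul1r ler_pM.
(* The margin e^(2N/q) between (5/2)^(2N) and e^(2N) is spent in two halves: one on e^a, one on the
   polynomial of degree 4d. *)
have AeN : expR (q^-1 * N%:R) * A <= C4 * expR N%:R ^+ 2.
  have -> : C4 * expR N%:R ^+ 2 = C4 * (expR 1 ^+ (2 * N)).
    have -> : expR N%:R = expR 1 ^+ N :> R by rewrite -expRM_natl mulr1.
    by rewrite -exprM mulnC.
  apply: (@le_trans _ _ (C4 * (5 / 2 * expR (q^-1)) ^+ (2 * N))); last first.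
    by rewrite ler_wpM2l ?(ltW C40)// lerXn2r ?nnegrE ?mulr_ge0 ?expR_ge0.
  rewrite exprMn -expRM_natl natrM.
  apply: (@le_trans _ _
    (expR (q^-1 * N%:R) * (C4 * expR (q^-1 * N%:R) * (5 / 2) ^+ (2 * N)))).
    by rewrite ler_wpM2l ?expR_ge0// ler_wpM2r ?exprn_ge0.
  have -> : expR (2 * N%:R * q^-1) = expR (q^-1 * N%:R) * expR (q^-1 * N%:R) :>
    R.
    by rewrite -expRD; congr expR; ring.
  by rewrite le_eqVlt; apply/orP; left; apply/eqP; ring.
have -> : (Num.sqrt Cc * expR N%:R * (T + eta)) ^+ 2 =
    K * ((c1 + c2) * (C4 * expR N%:R ^+ 2 * (T + eta) ^+ 2)).
  by rewrite exprMn [X in X * _]exprMn sqr_sqrtr ?(ltW Cc0)// /Cc; ring.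
rewrite ler_wpM2l ?expR_ge0// ler_wpM2l ?(ltW (addr_gt0 c10 c20))//.
by rewrite ler_wpM2r.
Qed.
End uniform_bound.

(** * Choice of the degree *)

Section asymptotics.
Context {R : realType}.

Lemma decayE (b : R) (N : nat) : (0 < N)%N ->
  decay b N = expR (- (N%:R * (ln N%:R / 2 - b))).
Proof.
move=> N0; have n1 : 1 <= N%:R :> R by rewrite ler1n.
have n0 : 0 < N%:R :> R by rewrite (lt_le_trans _ n1).
have s0 : 0 < Num.sqrt N%:R :> R by rewrite sqrtr_gt0.
have lnE : ln N%:R = 2 * ln (Num.sqrt N%:R) :> R.
  by rewrite -{1}[N%:R](@sqr_sqrtr R) ?ler0n// lnXn// mulr_natl.
rewrite /decay lnE -[X in X ^- N](lnK (x := Num.sqrt N%:R)) ?posrE//.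
by rewrite -expRM_natl -expRN -expRD; congr expR; field.
Qed.

(** Here u stands for log log(1/t), so [expR (- expR u)] is t and the right side is t^(-alpha) t.
    Half of delta makes [decay] at most t, the other half absorbs C and the rounding of N. *)
Lemma optimal_degree (C b delta : R) : 0 < C -> 0 <= b -> 0 < delta ->
  exists2 u0 : R, 1 <= u0 & forall u : R, u0 <= u ->
  exists2 N : nat, (0 < N)%N &
   C * expR N%:R * (expR (- expR u) + decay b N) <=
   expR ((2 + delta) / u * expR u) * expR (- expR u).
Proof.
move=> C0 b0 delta0.
(* Solves (1 + delta/4) (1 - kap) = 1: a relative loss kap in log N, caused by log u and b, is
   exactly affordable. *)
pose kap := (delta / 4) / (1 + delta / 4).
have kap0 : 0 < kap by rewrite divr_gt0 ?addr_gt0 ?divr_gt0.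
have kap1 : kap <= 1.
  by rewrite /kap ler_pdivrMr ?addr_gt0 ?divr_gt0// mul1r lerDr.
(* Beyond [ua], log u + 2b <= kap u; beyond [ub], log(2C) + 1 <= (delta/2) y, the 1 being the
   rounding of N. *)
pose ua := (2 * b - ln (kap / 2)) * (2 / kap).
pose ub := 4 / delta * (ln (2 * C) + 1).
exists (Num.max 1 (Num.max ua ub)); first by rewrite le_max lexx.
move=> u; rewrite !ge_max => /andP[u1 /andP[hua hub]].
have u0 : 0 < u by rewrite (lt_le_trans _ u1).
pose L := expR u; pose y := L / u.
have L0 : 0 < L by exact: expR_gt0.
have y0 : 0 < y by rewrite divr_gt0.
have yu : u / 2 <= y.
  rewrite /y ler_pdivlMr//.
  have := sum_exp_coeff_le 3 (ltW u0); rewrite !big_ord_recr big_ord0 /= -/L.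
  rewrite !factS fact0 expr0 expr1; lra.
have lnu : ln u + 2 * b <= kap * u.
  have k2 : 0 < kap / 2 by rewrite divr_gt0.
  have : ln (kap / 2 * u) < kap / 2 * u by apply: ln_sublinear;
    rewrite mulr_gt0.
  rewrite lnM ?posrE//.
  have : 2 * b - ln (kap / 2) <= u * (kap / 2).
    by rewrite -ler_pdivrMr// invf_div.
  lra.
have x0 : 0 <= (2 + delta / 2) * y by rewrite mulr_ge0 ?(ltW y0)//; lra.
have [N N0 [Nlo Nhi]] : exists2 N, (0 < N)%N &
    (2 + delta / 2) * y <= N%:R /\ N%:R <= (2 + delta / 2) * y + 1.
  exists (Num.truncn ((2 + delta / 2) * y)).+1 => //.
  have /andP[h1 h2] := truncn_itv x0.
  by split; [exact: ltW|rewrite -natr1 lerD2r].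
exists N => //.
have n0 : 0 < N%:R :> R by rewrite ltr0n.
have lnN : u - ln u <= ln N%:R.
  have -> : u - ln u = ln y by rewrite /y ln_div ?posrE// expRK.
  rewrite ler_ln ?posrE//; apply: le_trans Nlo.
  by rewrite ler_peMl ?(ltW y0)//; lra.
have dec : decay b N <= expR (- L).
  rewrite decayE// ler_expR lerN2.
  have h1 : (1 - kap) * u <= ln N%:R - 2 * b by lra.
  have h2 : 0 <= (1 - kap) * u.
    by rewrite mulr_ge0 ?(ltW u0)// subr_ge0.
  have -> : L = (2 + delta / 2) * y * ((1 - kap) * u / 2).
    rewrite /y /kap; field; rewrite (gt_eqF u0) gt_eqF ?addr_gt0//.
  apply: ler_pM => //; lra.
have CN : 2 * C * expR N%:R <= expR ((2 + delta) / u * L).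
  have -> : (2 + delta) / u * L = (2 + delta) * y by rewrite /y; ring.
  rewrite -[2 * C]lnK ?posrE ?mulr_gt0// -expRD ler_expR.
  have : ln (2 * C) + 1 <= delta / 2 * y.
    have : delta / 4 * ub <= delta / 4 * u by rewrite ler_wpM2l//; lra.
    have -> : delta / 4 * ub = ln (2 * C) + 1 by rewrite /ub; field;
      exact: lt0r_neq0.
    have := ler_wpM2l (ltW delta0) yu; lra.
  lra.
apply: (@le_trans _ _ (C * expR N%:R * (expR (- L) + expR (- L)))).
  by rewrite ler_wpM2l ?mulr_ge0 ?expR_ge0 ?(ltW C0)// lerD2l.
have -> : C * expR N%:R * (expR (- L) + expR (- L)) = 2 * C * expR N%:R * expR
  (- L) by ring.
by rewrite ler_wpM2r ?expR_ge0.
Qed.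

(** Serves the case of zero total variation, where only the truncation error remains and N is free
    to grow. *)
Lemma decay_vanish (C b e : R) : 0 < C -> 0 <= b -> 0 < e ->
  exists2 N : nat, (0 < N)%N & C * expR N%:R * decay b N <= e.
Proof.
move=> C0 b0 e0.
(* The first bound makes log N / 2 - b - 1 at least 1, so the product is at most C e^(-N); the
   second brings this below e. *)
pose x := Num.max (expR (4 + 2 * b)) (ln (C / e)).
have x0 : 0 <= x by rewrite le_max expR_ge0.
exists (Num.truncn x).+1 => //; set N := (Num.truncn x).+1.
have xN : x <= N%:R by have /andP[_ /ltW] := truncn_itv x0.
have N0 : 0 < N%:R :> R by rewrite ltr0n.
have [h1 h2] : expR (4 + 2 * b) <= N%:R /\ ln (C / e) <= N%:R.
  by split; apply: le_trans xN; rewrite le_max lexx ?orbT.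
have h3 : 4 + 2 * b <= ln N%:R.
  by rewrite -[leLHS]expRK ler_ln ?posrE ?expR_gt0.
rewrite decayE// -mulrA -expRD -ler_pdivlMl//.
rewrite -[leRHS]lnK ?posrE ?mulr_gt0 ?invr_gt0// ler_expR.
rewrite -[C^-1 * e]invrK lnV ?posrE ?invr_gt0 ?mulr_gt0 ?invr_gt0//.
rewrite invfM invrK mulrC in h2 *.
have : N%:R * 1 <= N%:R * (ln N%:R / 2 - b - 1)
  by rewrite ler_wpM2l ?(ltW N0)//; lra.
lra.
Qed.

End asymptotics.

Unset Implicit Arguments.
Set Strict Implicit.
Set Printing Implicit Defensive.

Theorem theorem2p1 (R : realType) (d : nat) (M delta : R)
    (hd : (1 <= d)%N) (hM : 0 < M) (hdelta : 0 < delta) :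
  exists C0 : R, 0 < C0 /\
    forall P Q : probability (Rd R d) R,
      P (cube M) = 1%E -> Q (cube M) = 1%E ->
      let f := gauss_mixture P in
      let g := gauss_mixture Q in
      (sqrte (chi2 f g) <=
        (Num.max C0 (TV f g `^ (- alpha delta (TV f g))) * TV f g)%:E)%E.
Proof.
have [C [b [C0 b0 core]]] := @chi2_le_TV_decay R d M hM.
have [u0 u01 hu] := optimal_degree C0 b0 hdelta.
(* The value of t at which log log(1/t) equals u0. *)
pose t0 := expR (- expR u0).
have t00 : 0 < t0 by exact: expR_gt0.
exists (C * expR 1 * (1 + decay b 1 / t0)); split.
  by rewrite mulr_gt0 ?mulr_gt0 ?expR_gt0// ltr_pwDl// divr_ge0 ?decay_ge0 ?ltW.
move=> P Q PD QD; cbv zeta; set f := gauss_mixture P; set g := gauss_mixture Q.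
have {}core := core P Q PD QD; rewrite -/f -/g in core *.
set t := TV f g in core *.
have tge0 : 0 <= t by rewrite /t /TV mulr_ge0 ?invr_ge0// Rintegral_ge0.
(* For t >= t0 the degree 1 suffices, since [decay b 1] is at most (decay b 1 / t0) t; this is the
   origin of C0. *)
have [tt0|tt0] := leP t0 t.
  apply: le_trans (core 1%N isT) _; rewrite lee_fin.
  apply: (@le_trans _ _ (C * expR 1 * (1 + decay b 1 / t0) * t)); last first.
    by rewrite ler_wpM2r// le_max lexx.
  rewrite -[leRHS]mulrA ler_wpM2l ?mulr_ge0 ?expR_ge0 ?(ltW C0)//.
  rewrite mulrDl mul1r lerD2l mulrAC -mulrA ler_peMr ?decay_ge0//.
  by rewrite ler_pdivlMr// mul1r.
(* At t = 0 the right side is 0, whatever value the power takes, so the divergence must be shown to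
   vanish; letting N grow does it. *)
have [t_0|t_gt0] := leP t 0.
  have t0E : t = 0 by apply/eqP; rewrite eq_le t_0 tge0.
  rewrite t0E mulr0; apply/lee_addgt0Pr => e e0; rewrite add0e.
  have [N N0 hN] := decay_vanish C0 b0 e0.
  by apply: le_trans (core N N0) _; rewrite t0E add0r lee_fin.
pose L := - ln t; pose u := ln L.
have L_ge : expR u0 <= L by rewrite /L lerNr -[leRHS]expRK ler_ln ?posrE// ltW.
have L0 : 0 < L by rewrite (lt_le_trans _ L_ge) ?expR_gt0.
have uu0 : u0 <= u by rewrite -[leLHS]expRK ler_ln ?posrE ?expR_gt0.
have Lu : expR u = L by rewrite lnK.
have tL : t = expR (- L) by rewrite /L opprK lnK.
(* As u0 >= 1, log(1/t) >= e, and the maximum in [alpha] is log(1/t). *)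
have alphaE : alpha delta t = (2 + delta) / u.
  rewrite /alpha div1r lnV ?posrE// -/L max_l// (le_trans _ L_ge)// ler_expR//.
have [N N0 hN] := hu u uu0; rewrite Lu -tL in hN.
apply: le_trans (core N N0) _; rewrite lee_fin (le_trans hN)// ler_wpM2r//.
rewrite le_max; apply/orP; right; rewrite alphaE /powR gt_eqF//.
by rewrite mulNr -mulrN.
Qed.
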